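(* $\mathsf{CD}^+\nvdash \forall\varphi\,(\mathrm T\mathrm T\varphi\vee\mathrm T\mathrm F\varphi\to\mathrm D\varphi)$, where $\varphi$ ranges over (codes of) sentences of $\mathcal L_{\mathrm D}$.
   Context: **Language and notation.** $\mathcal L_{\mathbb N}$ is the language of arithmetic over $\{\bar 0,\mathrm S,+,\times\}$ with finitely many additional function symbols for elementary syntactic operations: $\mathrm{num}$ (sending $n$ to the code of its numeral) and functions sending codes of expressions to the codes of their negation, conjunction, universal quantification, and the code of a term $t$ to the codes of the atomic formulas $\mathrm T(t)$, $\mathrm D(t)$, etc. $\mathcal L_{\mathrm D}=\mathcal L_{\mathbb N}\cup\{\mathrm T,\mathrm D\}$, with $\mathrm T,\mathrm D$ unary predicates. A Gödel numbering is fixed and expressions are identified with their codes. Logical primitives are $\neg,\wedge,\forall$, the others being defined. In axioms, $s,t$ range over codes of closed terms and $t^\circ$ is the value of $t$; $\varphi,\psi$ range over codes of sentences of $\mathcal L_{\mathrm D}$; $\varphi(v)$ ranges over codes of $\mathcal L_{\mathrm D}$-formulas with at most the variable $v$ free; $\varphi(t/v)$ is substitution. Connectives and predicates inside $\mathrm T$ or $\mathrm D$ denote the corresponding syntactic operations on codes. $\mathrm F x:=\mathrm T(\neg x)$ (with $\neg$ the syntactic negation function). $\mathrm T\mathrm T\varphi$ and $\mathrm T\mathrm F\varphi$ are $\mathrm T$ applied to the code of $\mathrm T(\mathrm{num}(\varphi))$, resp. of $\mathrm F(\mathrm{num}(\varphi))$. For $t$ a closed term code, $\mathrm T\mathrm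 T t$, $\mathrm T\mathrm D t$ are $\mathrm T$ applied to the code of $\mathrm T(t)$, $\mathrm D(t)$ respectively (similarly $\mathrm D\mathrm T t$, $\mathrm D\mathrm D t$). **$\mathsf{CD}^+$** is the $\mathcal L_{\mathrm D}$-theory consisting of $\mathsf{PA}$ with induction for all $\mathcal L_{\mathrm D}$-formulas and: - (T1) $\forall s\forall t(\mathrm T(s=t)\leftrightarrow s^\circ=t^\circ)$ - (T2$^+$) $\forall t(\mathrm D t^\circ\leftrightarrow \mathrm T\mathrm D t)$ - (T3) $\forall t(\mathrm D t^\circ\to(\mathrm T\mathrm T t\leftrightarrow \mathrm T t^\circ))$ - (T4) $\forall\varphi(\mathrm T(\neg\varphi)\leftrightarrow\neg\mathrm T\varphi)$ - (T5) $\forall\varphi,\psi(\mathrm T(\varphi\wedge\psi)\leftrightarrow \mathrm T\varphi\wedge\mathrm T\psi)$ - (T6) $\forall\varphi(v)(\mathrm T(\forall v\varphi)\leftrightarrow\forall t\,\mathrm T\varphi(t/v))$ - (D1) $\forall s\forall t\,\mathrm D(s=t)$ - (D2) $\forall t(\mathrm D\mathrm T t\leftrightarrow\mathrm D t^\circ)$ - (D3) $\forall t(\mathrm D\mathrm D t\leftrightarrow\mathrm D t^\circ)$ - (D4) $\forall\varphi(\mathrm D(\neg\varphi)\leftrightarrow\mathrm D\varphi)$ - (D5) $\forall\varphi,\psi\big(\mathrm D(\varphi\wedge\psi)\leftrightarrow((\mathrm D\varphi\wedge\mathrm D\psi)\vee(\mathrm D\varphi\wedge\mathrm T\neg\varphi)\vee(\mathrm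 D\psi\wedge\mathrm T\neg\psi))\big)$ - (D6) $\forall\varphi(v)\big(\mathrm D(\forall v\varphi)\leftrightarrow(\forall t\,\mathrm D\varphi(t/v)\vee\exists t(\mathrm D\varphi(t/v)\wedge\mathrm T\neg\varphi(t/v)))\big)$ - (R1) $\forall\varphi(v)\forall s\forall t(s^\circ=t^\circ\to(\mathrm T\varphi(s)\leftrightarrow\mathrm T\varphi(t)))$ - (R2) $\forall\varphi(v)\forall s\forall t(s^\circ=t^\circ\to(\mathrm D\varphi(s)\leftrightarrow\mathrm D\varphi(t)))$ *)

(* Defs.v *)
From mathcomp Require Import all_boot.
From Stdlib Require List.

Set Implicit Arguments.
Unset Strict Implicit.
Unset Printing Implicit Defensive.

(* Besides 0, S, +, * there are symbols for syntactic operations on codes: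
     fnum n   = code of the n-th numeral
     fneg p   = code of the negation of p
     fT t, fD t = codes of T(t) and D(t), t being the code of a term
     fF t     = code of F(t), i.e. of T(negc t), negc being the symbol fneg
     feq s t  = code of s = t
     fand p q = code of the conjunction of p and q
     fall v p = code of the quantification of p over the v-th variable. *)
Inductive fun1 := fsuc | fnum | fneg | fT | fD | fF.
Inductive fun2 := fadd | fmul | feq | fand | fall.

Inductive term :=
  | Var of nat
  | Zero
  | Fn1 of fun1 & term
  | Fn2 of fun2 & term & term.

Inductive form :=
  | FEq of term & term
  | FT of term
  | FD of term
  | FNeg of form
  | FAnd of form & form
  | FAll of nat & form.

Definition FImp p q := FNeg (FAnd p (FNeg q)).

Fixpoint fvt (t : term) : seq nat :=
  match t with
  | Var n => [:: n]
  | Zero => [::]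
  | Fn1 _ s => fvt s
  | Fn2 _ s u => fvt s ++ fvt u
  end.

Fixpoint fv (p : form) : seq nat :=
  match p with
  | FEq s t => fvt s ++ fvt t
  | FT t | FD t => fvt t
  | FNeg q => fv q
  | FAnd q r => fv q ++ fv r
  | FAll x q => [seq y <- fv q | y != x]
  end.

Fixpoint substt (x : nat) (s t : term) : term :=
  match t with
  | Var n => if n == x then s else Var n
  | Zero => Zero
  | Fn1 f u => Fn1 f (substt x s u)
  | Fn2 f u v => Fn2 f (substt x s u) (substt x s v)
  end.

(* Replaces the free occurrences of x by s, without renaming. *)
Fixpoint subst (x : nat) (s : term) (p : form) : form :=
  match p with
  | FEq t u => FEq (substt x s t) (substt x s u)
  | FT t => FT (substt x s t)
  | FD t => FD (substt x s t)
  | FNeg q => FNeg (subst x s q)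
  | FAnd q r => FAnd (subst x s q) (subst x s r)
  | FAll y q => if y == x then p else FAll y (subst x s q)
  end.

(* s is free for x in p: the substitution of s for x in p captures nothing. *)
Fixpoint free_for (s : term) (x : nat) (p : form) : bool :=
  match p with
  | FEq _ _ | FT _ | FD _ => true
  | FNeg q => free_for s x q
  | FAnd q r => free_for s x q && free_for s x r
  | FAll y q => (x \notin fv p) || ((y \notin fvt s) && free_for s x q)
  end.

Definition extend (G : form -> Prop) (p : form) : form -> Prop :=
  fun q => G q \/ q = p.

Reserved Notation "G |-- p" (at level 80, no associativity).

Inductive proves : (form -> Prop) -> form -> Prop :=
  | nd_hyp G p : G p -> G |-- p
  | nd_andI G p q : G |-- p -> G |-- q -> G |-- FAnd p q
  | nd_andEl G p q : G |-- FAnd p q -> G |-- p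
  | nd_andEr G p q : G |-- FAnd p q -> G |-- q
  | nd_negI G p q : extend G p |-- q -> extend G p |-- FNeg q -> G |-- FNeg p
  | nd_raa G p q :
      extend G (FNeg p) |-- q -> extend G (FNeg p) |-- FNeg q -> G |-- p
  | nd_allI G x p : (forall q, G q -> x \notin fv q) -> G |-- p -> G |-- FAll x p
  | nd_allE G x t p : free_for t x p -> G |-- FAll x p -> G |-- subst x t p
  | nd_refl G t : G |-- FEq t t
  | nd_leibniz G s t x p : free_for s x p -> free_for t x p ->
      G |-- FEq s t -> G |-- subst x s p -> G |-- subst x t p
where "G |-- p" := (proves G p).

(* Injective, because (a + b)^2 <= (a + b)^2 + a < (a + b + 1)^2; chosen since
   it is the value of a term of the language of arithmetic. *)
Definition cpair (a b : nat) : nat := (a + b) * (a + b) + a.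

Definition tag1 (f : fun1) : nat :=
  match f with
  | fsuc => 3 | fnum => 4 | fneg => 5 | fT => 6 | fD => 7 | fF => 8
  end.

Definition tag2 (f : fun2) : nat :=
  match f with fadd => 9 | fmul => 10 | feq => 11 | fand => 12 | fall => 13 end.

Definition tag_var := 1.
Definition tag_zero := 2.
Definition tag_eq := 14.
Definition tag_T := 15.
Definition tag_D := 16.
Definition tag_neg := 17.
Definition tag_and := 18.
Definition tag_all := 19.

Fixpoint code_term (t : term) : nat :=
  match t with
  | Var n => cpair tag_var n
  | Zero => cpair tag_zero 0
  | Fn1 f s => cpair (tag1 f) (code_term s)
  | Fn2 f s u => cpair (tag2 f) (cpair (code_term s) (code_term u))
  end.

(* The axioms of CD+ only refer to codes through L_D-formulas; [code] is the
   numbering that these formulas describe. *)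
Fixpoint code (p : form) : nat :=
  match p with
  | FEq s t => cpair tag_eq (cpair (code_term s) (code_term t))
  | FT t => cpair tag_T (code_term t)
  | FD t => cpair tag_D (code_term t)
  | FNeg q => cpair tag_neg (code q)
  | FAnd q r => cpair tag_and (cpair (code q) (code r))
  | FAll x q => cpair tag_all (cpair x (code q))
  end.

(* An [oform] is an L_D-formula built at a level k: the parameters occurring in
   it are terms in the variables below k, and a quantifier at level k binds the
   k-th variable.  Hence no capture can occur, and [p 0] is a sentence as soon
   as every variable of p is introduced by a quantifier of p. *)
Definition oform := nat -> form.

Definition oEq s t : oform := fun _ => FEq s t.
Definition oT t : oform := fun _ => FT t.
Definition oD t : oform := fun _ => FD t.
Definition oNeg (p : oform) : oform := fun k => FNeg (p k).
Definition oAnd (p q : oform) : oform := fun k => FAnd (p k) (q k).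
Definition oOr p q := oNeg (oAnd (oNeg p) (oNeg q)).
Definition oImp p q := oNeg (oAnd p (oNeg q)).
Definition oIff p q := oAnd (oImp p q) (oImp q p).
Definition oAll (P : term -> oform) : oform := fun k => FAll k (P (Var k) k.+1).
Definition oEx (P : term -> oform) := oNeg (oAll (fun x => oNeg (P x))).

Declare Scope oform_scope.
Delimit Scope oform_scope with L.
Bind Scope oform_scope with oform.
Notation "s ≐ t" := (oEq s t) (at level 70, no associativity) : oform_scope.
Notation "¬ p" := (oNeg p) (at level 75, right associativity) : oform_scope.
Notation "p ∧ q" := (oAnd p q) (at level 80, right associativity) : oform_scope.
Notation "p ∨ q" := (oOr p q) (at level 85, right associativity) : oform_scope.
Notation "p → q" := (oImp p q) (at level 99, right associativity,
  q at level 200) : oform_scope.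
Notation "p ↔ q" := (oIff p q) (at level 95, no associativity) : oform_scope.
Notation "∀ x .. y , p" := (oAll (fun x => .. (oAll (fun y => p%L)) ..))
  (at level 200, x binder, y binder, right associativity) : oform_scope.
Notation "∃ x .. y , p" := (oEx (fun x => .. (oEx (fun y => p%L)) ..))
  (at level 200, x binder, y binder, right associativity) : oform_scope.
Local Open Scope oform_scope.

Definition oOrs (ps : seq oform) : oform :=
  foldr oOr (Zero ≐ Fn1 fsuc Zero) ps.

Notation tS := (Fn1 fsuc).
Notation num := (Fn1 fnum).
Notation negc := (Fn1 fneg).
Notation Tc := (Fn1 fT).
Notation Dc := (Fn1 fD).
Notation Fc := (Fn1 fF).
Notation tadd := (Fn2 fadd).
Notation tmul := (Fn2 fmul).
Notation eqc := (Fn2 feq).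
Notation andc := (Fn2 fand).
Notation allc := (Fn2 fall).

Definition numeral (n : nat) : term := iter n tS Zero.
Definition tpair (s t : term) : term := tadd (tmul (tadd s t) (tadd s t)) s.

(* The object-level counterparts of the clauses of [code_term]. *)
Definition varc (t : term) : term := tpair (numeral tag_var) t.
Definition zeroc : term := tpair (numeral tag_zero) Zero.
Definition app1c (f : fun1) (t : term) : term := tpair (numeral (tag1 f)) t.
Definition app2c (f : fun2) (s t : term) : term :=
  tpair (numeral (tag2 f)) (tpair s t).

Definition uclosure (p : form) : form := foldr FAll p (fv p).

Definition induction (x : nat) (p : form) : form :=
  uclosure (FImp (FAnd (subst x Zero p)
                       (FAll x (FImp p (subst x (tS (Var x)) p))))
                 (FAll x p)).

(* The last group consists of the defining equations of the symbols for
   syntactic operations. *)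
Definition PA_basic : seq oform :=
  [:: ∀ x, ¬ Zero ≐ tS x
    ; ∀ x y, tS x ≐ tS y → x ≐ y
    ; ∀ x, tadd x Zero ≐ x
    ; ∀ x y, tadd x (tS y) ≐ tS (tadd x y)
    ; ∀ x, tmul x Zero ≐ Zero
    ; ∀ x y, tmul x (tS y) ≐ tadd (tmul x y) x

    ; num Zero ≐ zeroc
    ; ∀ x, num (tS x) ≐ app1c fsuc (num x)
    ; ∀ x, negc x ≐ tpair (numeral tag_neg) x
    ; ∀ x, Tc x ≐ tpair (numeral tag_T) x
    ; ∀ x, Dc x ≐ tpair (numeral tag_D) x
    ; ∀ x, Fc x ≐ tpair (numeral tag_T) (app1c fneg x)
    ; ∀ x y, eqc x y ≐ tpair (numeral tag_eq) (tpair x y)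
    ; ∀ x y, andc x y ≐ tpair (numeral tag_and) (tpair x y)
    ; ∀ x y, allc x y ≐ tpair (numeral tag_all) (tpair x y)].

(* Finite sets of numbers are coded by triples (a, b, m):
   z belongs to (a, b, m) iff z <= m and 1 + (z + 1) b divides a.  For b a
   multiple of (m + 1)! these moduli are pairwise coprime for z <= m, so that
   every subset of {0, ..., m} is coded. *)
Definition oMem (a b m z : term) : oform :=
  (∃ d, tadd d z ≐ m) ∧ (∃ q, tmul q (tS (tmul (tS z) b)) ≐ a).

(* x belongs to a finite set each element z of which is obtained by [step] from
   elements of the set.  In all uses below, [step] passes from z to codes of
   immediate subexpressions (in the first component if z is a pair), so that this
   defines the set inductively generated by [step]. *)
Definition oInd (step : (term -> oform) -> term -> oform) (x : term) : oform :=
  ∃ a b m, oMem a b m x ∧ ∀ z, oMem a b m z → step (oMem a b m) z.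

Definition funs1 := [:: fsuc; fnum; fneg; fT; fD; fF].
Definition funs2 := [:: fadd; fmul; feq; fand; fall].

(* x codes a term *)
Definition oTerm : term -> oform := oInd (fun R z =>
  oOrs ([:: ∃ n, z ≐ varc n ; z ≐ zeroc]
    ++ [seq ∃ x, z ≐ app1c f x ∧ R x | f <- funs1]
    ++ [seq ∃ x y, z ≐ app2c f x y ∧ R x ∧ R y | f <- funs2])).

(* x codes a formula of L_D *)
Definition oForm : term -> oform := oInd (fun R z =>
  oOrs [:: ∃ s t, z ≐ eqc s t ∧ oTerm s ∧ oTerm t
         ; ∃ t, z ≐ Tc t ∧ oTerm t
         ; ∃ t, z ≐ Dc t ∧ oTerm t
         ; ∃ x, z ≐ negc x ∧ R x
         ; ∃ x y, z ≐ andc x y ∧ R x ∧ R y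
         ; ∃ v x, z ≐ allc v x ∧ R x]).

(* Constructors of terms and formulas other than variables, 0 and the
   quantifier: substitution and free variables commute with them. *)
Definition ops1 : seq (term -> term) := map app1c funs1 ++ [:: Tc; Dc; negc].
Definition ops2 : seq (term -> term -> term) :=
  map app2c funs2 ++ [:: eqc; andc].

(* The v-th variable occurs free in the term or formula coded by x. *)
Definition oFree (v : term) : term -> oform := oInd (fun R z =>
  oOrs ([:: z ≐ varc v]
    ++ [seq ∃ x, z ≐ c x ∧ R x | c <- ops1]
    ++ [seq ∃ x y, z ≐ c x y ∧ (R x ∨ R y) | c <- ops2]
    ++ [:: ∃ u x, z ≐ allc u x ∧ ¬ u ≐ v ∧ R x])).

(* q codes the result of substituting the term coded by t for the free
   occurrences of the v-th variable in the term or formula coded by p.  There is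
   no renaming: t is only ever closed. *)
Definition oSubst (v t p q : term) : oform := oInd (fun R z =>
  ∃ x y, z ≐ tpair x y ∧
  oOrs ([:: x ≐ varc v ∧ y ≐ t
          ; ∃ u, x ≐ varc u ∧ ¬ u ≐ v ∧ y ≐ x
          ; x ≐ zeroc ∧ y ≐ x]
    ++ [seq ∃ x1 y1, x ≐ c x1 ∧ y ≐ c y1 ∧ R (tpair x1 y1) | c <- ops1]
    ++ [seq ∃ x1 x2 y1 y2, x ≐ c x1 x2 ∧ y ≐ c y1 y2
              ∧ R (tpair x1 y1) ∧ R (tpair x2 y2) | c <- ops2]
    ++ [:: ∃ x1, x ≐ allc v x1 ∧ y ≐ x
         ; ∃ u x1 y1, x ≐ allc u x1 ∧ ¬ u ≐ v ∧ y ≐ allc u y1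
              ∧ R (tpair x1 y1)])) (tpair p q).

(* The closed term coded by t has value w.  The functions themselves are
   symbols of the language, which makes the clauses atomic. *)
Definition oVal (t w : term) : oform := oInd (fun R z =>
  ∃ x y, z ≐ tpair x y ∧
  oOrs ([:: x ≐ zeroc ∧ y ≐ Zero]
    ++ [seq ∃ x1 y1, x ≐ app1c f x1 ∧ y ≐ Fn1 f y1 ∧ R (tpair x1 y1)
        | f <- funs1]
    ++ [seq ∃ x1 x2 y1 y2, x ≐ app2c f x1 x2 ∧ y ≐ Fn2 f y1 y2
              ∧ R (tpair x1 y1) ∧ R (tpair x2 y2) | f <- funs2])) (tpair t w).

Definition oClTerm (x : term) : oform := oTerm x ∧ ∀ v, ¬ oFree v x.
Definition oSent (x : term) : oform := oForm x ∧ ∀ v, ¬ oFree v x.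
(* x codes a formula with at most the v-th variable free *)
Definition oForm1 (v x : term) : oform :=
  oForm x ∧ ∀ u, oFree u x → u ≐ v.

(* Quantifiers over (codes of) closed terms, sentences, and formulas p with at
   most the v-th variable free. *)
Definition allTerm (P : term -> oform) : oform := ∀ t, oClTerm t → P t.
Definition exTerm (P : term -> oform) : oform := ∃ t, oClTerm t ∧ P t.
Definition allSent (P : term -> oform) : oform := ∀ p, oSent p → P p.
Definition allForm1 (P : term -> term -> oform) : oform :=
  ∀ v p, oForm1 v p → P v p.

(* P(t°) *)
Definition atVal (t : term) (P : term -> oform) : oform := ∃ y, oVal t y ∧ P y.
(* P(p(t/v)) *)
Definition atSubst (p t v : term) (P : term -> oform) : oform :=
  ∃ q, oSubst v t p q ∧ P q.

(* s° = t° *)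
Definition oSameVal (s t : term) : oform :=
  atVal s (fun a => atVal t (fun b => a ≐ b)).

Definition CD_T1 : oform :=
  allTerm (fun s => allTerm (fun t => oT (eqc s t) ↔ oSameVal s t)).

Definition CD_T2plus : oform :=
  allTerm (fun t => atVal t oD ↔ oT (Dc t)).

Definition CD_T3 : oform :=
  allTerm (fun t => atVal t oD → (oT (Tc t) ↔ atVal t oT)).

Definition CD_T4 : oform :=
  allSent (fun p => oT (negc p) ↔ ¬ oT p).

Definition CD_T5 : oform :=
  allSent (fun p => allSent (fun q => oT (andc p q) ↔ oT p ∧ oT q)).

Definition CD_T6 : oform :=
  allForm1 (fun v p =>
    oT (allc v p) ↔ allTerm (fun t => atSubst p t v oT)).

Definition CD_D1 : oform :=
  allTerm (fun s => allTerm (fun t => oD (eqc s t))).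

Definition CD_D2 : oform :=
  allTerm (fun t => oD (Tc t) ↔ atVal t oD).

Definition CD_D3 : oform :=
  allTerm (fun t => oD (Dc t) ↔ atVal t oD).

Definition CD_D4 : oform :=
  allSent (fun p => oD (negc p) ↔ oD p).

Definition CD_D5 : oform :=
  allSent (fun p => allSent (fun q =>
    oD (andc p q) ↔
      (oD p ∧ oD q) ∨ (oD p ∧ oT (negc p)) ∨ (oD q ∧ oT (negc q)))).

Definition CD_D6 : oform :=
  allForm1 (fun v p =>
    oD (allc v p) ↔
      allTerm (fun t => atSubst p t v oD)
      ∨ exTerm (fun t => atSubst p t v (fun q => oD q ∧ oT (negc q)))).

Definition CD_R1 : oform :=
  allForm1 (fun v p => allTerm (fun s => allTerm (fun t =>
    oSameVal s t → (atSubst p s v oT ↔ atSubst p t v oT)))).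

Definition CD_R2 : oform :=
  allForm1 (fun v p => allTerm (fun s => allTerm (fun t =>
    oSameVal s t → (atSubst p s v oD ↔ atSubst p t v oD)))).

Definition CD_axioms : seq oform :=
  [:: CD_T1; CD_T2plus; CD_T3; CD_T4; CD_T5; CD_T6;
      CD_D1; CD_D2; CD_D3; CD_D4; CD_D5; CD_D6; CD_R1; CD_R2].

Inductive CDplus : form -> Prop :=
  | CDplus_PA p : List.In p PA_basic -> CDplus (p 0)
  | CDplus_induction x p : CDplus (induction x p)
  | CDplus_CD p : List.In p CD_axioms -> CDplus (p 0).

(* Main.v *)
From mathcomp Require Import all_boot.
From mathcomp Require Import zify.
From Stdlib Require Import Classical.
Require Import Defs.

Set Implicit Arguments.
Unset Strict Implicit.
Unset Printing Implicit Defensive.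

(** The unprovability is shown by a standard model: a structure (N, T, D) that
satisfies every axiom but in which TT holds of a sentence outside D.

Call a sentence determinate, with truth value b, according to the least fixed
point [det] of the strong Kleene valuation in which T t has the value of the
sentence coded by t, if that sentence has one, and D t is true if t codes a
determinate sentence and is never false.  Let D be the set of determinate
sentences ([D_ext]).  The predicate T of the model cannot be read off from D, and
this is the point: by the compositional axioms it is the set [T_ext] of the
sentences true in some structure (N, X, D), where X interprets the inner
occurrences of T, and (T3) constrains X only on D, where X and T must agree.
Outside D the set X is arbitrary.  It is taken as large as possible: X
([inner_T]) contains all numbers that do not code a determinately false sentence.

Agreement on D follows from two facts.  The least fixed point is consistent
([det_consistent]), and Kleene valuations are monotone ([val_mono]); hence
determinate sentences keep their value in (N, X, D) ([det_inner], [D_T]).  The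
axioms (D1) to (D6) are the clauses of the Kleene valuation ([det_fix]).

Now let p be T(0).  Since 0 is not the code of a sentence, p is not determinate
([T0_not_determinate]), so p belongs to X, and T(T(num p)) holds while D(p) fails.

It remains to see that the axioms, in which syntax is arithmetized, have their
intended meaning in N.  Inductive definitions are expressed by coded finite sets,
so this rests on the coding lemma [code_finite]; [holds_ind] transfers it to the
formulas, and the lemmas [Free_form], [Subst_form], [Val_term] and their likes
identify the sets so defined with the actual syntactic relations.  *)

(** * Signed valuations *)

Definition interp1 (f : fun1) (n : nat) : nat :=
  match f with
  | fsuc => n.+1
  | fnum => code_term (numeral n)
  | fneg => cpair tag_neg n
  | fT => cpair tag_T n
  | fD => cpair tag_D n
  | fF => cpair tag_T (cpair (tag1 fneg) n)
  end.

Definition interp2 (f : fun2) (m n : nat) : nat :=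
  match f with
  | fadd => m + n
  | fmul => m * n
  | feq => cpair tag_eq (cpair m n)
  | fand => cpair tag_and (cpair m n)
  | fall => cpair tag_all (cpair m n)
  end.

Definition env := nat -> nat.
Definition upd (e : env) x n : env := fun y => if y == x then n else e y.

Fixpoint eval (e : env) (t : term) : nat :=
  match t with
  | Var x => e x
  | Zero => 0
  | Fn1 f s => interp1 f (eval e s)
  | Fn2 f s u => interp2 f (eval e s) (eval e u)
  end.

(** A pair of sets: the numbers of which a predicate is true (sign true) and
those of which it is false.  The two need be neither disjoint nor exhaustive. *)
Definition signed_set := bool -> nat -> Prop.

(** [val T D b e p]: p has truth value b under e by the strong Kleene clauses.
Classical truth is the case of complementary signed sets, so that substitution
and extensionality are proved once for truth and for determinateness. *)
Fixpoint val (T D : signed_set) (b : bool) (e : env) (p : form) : Prop :=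
  match p with
  | FEq s t => (eval e s == eval e t) = b
  | FT t => T b (eval e t)
  | FD t => D b (eval e t)
  | FNeg q => val T D (~~ b) e q
  | FAnd q r => if b then val T D true e q /\ val T D true e r
                else val T D false e q \/ val T D false e r
  | FAll x q => if b then forall n, val T D true (upd e x n) q
                else exists n, val T D false (upd e x n) q
  end.

Definition classic_set (X : nat -> Prop) : signed_set := fun b n => if b then X n else ~ X n.

Definition sat X Y e p := val (classic_set X) (classic_set Y) true e p.

Lemma eval_agree e e' t : {in fvt t, e =1 e'} -> eval e t = eval e' t.
Proof.
elim: t => //= [x|f s IHs|f s IHs u IHu] H; first by apply: H; rewrite inE.
- by rewrite IHs.
- by rewrite IHs ?IHu // => x xs; apply: H; rewrite mem_cat xs ?orbT.
Qed.

Lemma val_agree T D b e e' p : {in fv p, e =1 e'} ->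
  val T D b e p -> val T D b e' p.
Proof.
elim: p b e e' => /= [s t|t|t|q IH|q IHq r IHr|x q IH] b e e' H.
- by rewrite (@eval_agree e e' s) ?(@eval_agree e e' t) // => x xs; apply: H;
    rewrite mem_cat xs ?orbT.
- by rewrite (@eval_agree e e').
- by rewrite (@eval_agree e e').
- exact: IH.
- have Hq : {in fv q, e =1 e'} by move=> x xs; apply: H; rewrite mem_cat xs.
  have Hr : {in fv r, e =1 e'} by move=> x xs; apply: H; rewrite mem_cat xs orbT.
  by case: b => -[]; eauto.
- have Hx n : {in fv q, upd e x n =1 upd e' x n}.
    move=> y yq; rewrite /upd; case: eqP => // /eqP nyx.
    by apply: H; rewrite mem_filter nyx.
  case: b => [Hq n|[n Hq]]; first exact: IH (Hx n) (Hq n).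
  by exists n; exact: IH (Hx n) Hq.
Qed.

Lemma val_eqenv T D b e e' p : e =1 e' -> val T D b e p -> val T D b e' p.
Proof. by move=> H; apply: val_agree => x _. Qed.

Lemma eval_subst e x s t : eval e (substt x s t) = eval (upd e x (eval e s)) t.
Proof.
elim: t => //= [y|f t ->|f t -> u ->] //.
by rewrite /upd; case: eqP.
Qed.

Lemma substt_id x s t : x \notin fvt t -> substt x s t = t.
Proof.
elim: t => //= [y|f t IH H|f t IHt u IHu].
- by rewrite inE eq_sym; case: eqP.
- by rewrite IH.
- by rewrite mem_cat negb_or => /andP[? ?]; rewrite IHt ?IHu.
Qed.

Lemma subst_id x s p : x \notin fv p -> subst x s p = p.
Proof.
elim: p => /= [t u|t|t|q IH|q IHq r IHr|y q IH].
- by rewrite mem_cat negb_or => /andP[? ?]; rewrite !substt_id.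
- by move=> ?; rewrite substt_id.
- by move=> ?; rewrite substt_id.
- by move=> ?; rewrite IH.
- by rewrite mem_cat negb_or => /andP[? ?]; rewrite IHq ?IHr.
- rewrite mem_filter negb_and negbK; case: eqVneq => //= _ H.
  by rewrite IH.
Qed.

(** When y is bound in p and x does not occur in the body, s may contain y, but
then the substitution does nothing. *)
Lemma val_subst T D b e x s p : free_for s x p ->
  val T D b e (subst x s p) <-> val T D b (upd e x (eval e s)) p.
Proof.
elim: p b e => /= [t u|t|t|q IH|q IHq r IHr|y q IH] b e; try by rewrite !eval_subst.
- exact: IH.
- by case/andP=> /IHq Hq /IHr Hr; case: b; rewrite Hq Hr.
case: eqVneq => [-> _|nyx H].
  suff E n : upd e x n =1 upd (upd e x (eval e s)) x n.
    have {}E b' n : val T D b' (upd e x n) q <->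
        val T D b' (upd (upd e x (eval e s)) x n) q.
      by split; apply: val_eqenv => z; rewrite E.
    by case: b; [split=> H n; apply/E | split=> -[n /E]; exists n].
  by move=> z; rewrite /upd; case: eqP.
have {H} Hn n : val T D b (upd e y n) (subst x s q) <->
    val T D b (upd (upd e x (eval e s)) y n) q.
  have sw c : upd (upd e x c) y n =1 upd (upd e y n) x c.
    move=> z; rewrite /upd; case: (eqVneq z y) => [->|//].
    by rewrite (negbTE nyx).
  case/orP: H => [xq|/andP[ys fq]].
    have {}xq : x \notin fv q by move: xq; rewrite mem_filter eq_sym nyx.
    rewrite subst_id //; split; apply: val_agree => z zq; rewrite /upd;
      by case: (eqVneq z x) zq xq => // -> ->.
  rewrite IH //.
  have -> : eval (upd e y n) s = eval e s.
    apply: eval_agree => z zs; rewrite /upd; case: eqP zs => // ->.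
    by rewrite (negbTE ys).
  by split; apply: val_eqenv => z; rewrite sw.
by case: b Hn => Hn; [split=> H n; apply/Hn | split=> -[n /Hn]; exists n].
Qed.

(** Negation only exchanges the signs, so every occurrence of T and D is positive
in the sense of signed sets. *)
Lemma val_mono T D T' D' b e p :
  (forall b n, T b n -> T' b n) -> (forall b n, D b n -> D' b n) ->
  val T D b e p -> val T' D' b e p.
Proof.
move=> HT HD; elim: p b e => //= [t|t|q IH|q IHq r IHr|x q IH] b e; eauto.
- by case: b => -[]; eauto.
- by case: b => [H n|[n H]]; eauto.
Qed.

(** Applied with (T', D') = (T, D), this is consistency; the two pairs are kept
apart because in the inductive step of [det_consistent] only one of them is known
to satisfy the induction hypothesis. *)
Lemma val_disjoint T D T' D' b e p :
  (forall b n, T b n -> T' (~~ b) n -> False) ->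
  (forall b n, D b n -> D' (~~ b) n -> False) ->
  val T D b e p -> val T' D' (~~ b) e p -> False.
Proof.
move=> HT HD; elim: p b e => /= [s t|t|t|q IH|q IHq r IHr|x q IH] b e; eauto.
- by move=> ->; case: b.
- case: b => /=.
    by move=> [Hq Hr] []; [apply: (IHq true e) | apply: (IHr true e)].
  by move=> [H|H] []; [move=> H' _; apply: (IHq false e) | move=> _ H'; apply: (IHr false e)].
- case: b => /= [H [n H']|[n H] H']; last exact: (IH false (upd e x n)).
  exact: (IH true (upd e x n)).
Qed.

(** * Soundness of natural deduction *)
Section Sat.
Variables X Y : nat -> Prop.

Lemma sat_neg e p : sat X Y e (FNeg p) <-> ~ sat X Y e p.
Proof.
rewrite /sat /=; split=> [H H'|].
  by apply: (val_disjoint _ _ H' H) => -[].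
elim: p e => /= [s t|t|t|q IH|q IHq r IHr|x q IH] e //.
- by case: eqP.
- by move=> H; apply: NNPP => /IH.
- by move=> H; case: (classic (val (classic_set X) (classic_set Y) true e q));
    [right; apply: IHr => ? |left; apply: IHq]; tauto.
- by move=> /not_all_ex_not[n H]; exists n; apply: IH.
Qed.

Lemma sat_imp e p q : sat X Y e (FImp p q) <-> (sat X Y e p -> sat X Y e q).
Proof.
rewrite {1}/sat /=; move: (sat_neg e p); rewrite {1}/sat /= => ->.
by rewrite -/(sat X Y e q); case: (classic (sat X Y e p)); tauto.
Qed.

Lemma soundness G p e : G |-- p -> (forall q, G q -> sat X Y e q) -> sat X Y e p.
Proof.
move=> d; elim: d e => {G p}.
- by move=> G p Gp e H; apply: H.
- by move=> G p q _ IHp _ IHq e H; split; [apply: IHp | apply: IHq].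
- by move=> G p q _ IH e /IH[].
- by move=> G p q _ IH e /IH[].
- move=> G p q _ IH1 _ IH2 e H; apply/sat_neg => Hp.
  have H' r : extend G p r -> sat X Y e r by case=> [/H|->].
  by move/sat_neg: (IH2 e H'); apply; apply: IH1.
- move=> G p q _ IH1 _ IH2 e H; apply: NNPP => /sat_neg Hp.
  have H' r : extend G (FNeg p) r -> sat X Y e r by case=> [/H|->].
  by move/sat_neg: (IH2 e H'); apply; apply: IH1.
- move=> G x p xG _ IH e H n; apply: IH => q Gq.
  apply: val_agree (H q Gq) => y yq; rewrite /upd; case: eqP => // yx.
  by move: (xG q Gq); rewrite -yx yq.
- by move=> G x t p ff _ IH e /IH Hp; apply/val_subst.
- by move=> G t e _; rewrite /sat /= eqxx.
- move=> G s t x p fs ft _ IH1 _ IH2 e H; apply/val_subst => //.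
  move: (IH1 e H) (IH2 e H) => /eqP <-.
  by rewrite /sat val_subst.
Qed.

Lemma sat_uclosure p e : (forall e, sat X Y e p) -> sat X Y e (uclosure p).
Proof.
move=> H; rewrite /uclosure; elim: (fv p) e => [|x s IH] e //= n; exact: IH.
Qed.

Lemma free_for_succ x p : free_for (Fn1 fsuc (Var x)) x p.
Proof.
elim: p => //= [q -> r -> //|y q ->].
by rewrite mem_filter inE; case: (eqVneq x y); rewrite //= ?orbT.
Qed.

Lemma free_for_closed x s p : fvt s = [::] -> free_for s x p.
Proof.
by move=> H; elim: p => //= [q -> r -> //|y q ->]; rewrite H orbT.
Qed.

Lemma sat_induction x p e : sat X Y e (induction x p).
Proof.
apply: sat_uclosure => {}e; apply/sat_imp => -[H0 HS].
elim=> [|n IH].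
  by apply: (iffLR (val_subst _ _ _ _ (free_for_closed x p _)) H0).
have /val_subst := iffLR (sat_imp _ _ _) (HS n) IH.
move/(_ (free_for_succ x p)); apply: val_eqenv => z.
by rewrite /= /upd eqxx; case: eqP.
Qed.
End Sat.

(** * Coding *)
(** * Coding of finite sets *)
Lemma cpair_gt0 a b : 0 < a -> b < cpair a b.
Proof. by rewrite /cpair; nia. Qed.

Lemma cpair_gel a b : a <= cpair a b.
Proof. by rewrite /cpair; nia. Qed.

Lemma cpair_ger a b : b <= cpair a b.
Proof. by rewrite /cpair; nia. Qed.

Lemma cpair_inj a b c d : cpair a b = cpair c d -> a = c /\ b = d.
Proof.
rewrite /cpair => H; have E : a + b = c + d by nia.
by move: H; rewrite E; lia.
Qed.

Definition modulus b z := (z.+1 * b).+1.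

(** A common divisor g of both moduli is coprime to b = (m + 1)! and divides
(j - i) b, hence it divides j - i, which divides b. *)
Lemma coprime_moduli m i j : i <= m -> j <= m -> i < j ->
  coprime (modulus m.+1`! i) (modulus m.+1`! j).
Proof.
move=> im jm ij; set b := m.+1`!; set g := gcdn (modulus b i) (modulus b j).
have gi : g %| modulus b i := dvdn_gcdl _ _.
have gj : g %| modulus b j := dvdn_gcdr _ _.
have cgb : coprime g b.
  by apply: coprime_dvdl gi _; have := coprimeSn (i.+1 * b); rewrite coprimeMr => /andP[].
have : g %| (j - i) * b.
  have -> : (j - i) * b = modulus b j - modulus b i by rewrite /modulus; nia.
  exact: dvdn_sub.
rewrite Gauss_dvdl // => gd.
have gb : g %| b by apply: dvdn_trans gd _; apply: dvdn_fact; lia.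
by rewrite /coprime -/g -(gcdn_idPl gb).
Qed.

(** Take for a the product of the moduli of the elements: the modulus of any other
z <= m is coprime to a and larger than 1. *)
Lemma code_finite (s : seq nat) : exists a b m, forall z,
  (exists d, d + z = m) /\ (exists q, q * (z.+1 * b).+1 = a) <-> z \in s.
Proof.
pose m := \max_(i <- s) i; pose b := m.+1`!.
exists (\prod_(i <- s) modulus b i), b, m => z.
have le_m i : i \in s -> i <= m by move=> si; apply: leq_bigmax_seq.
split=> [[[d zm] [q qa]]|zs]; last first.
  split; first by exists (m - z); rewrite subnK ?le_m.
  have /dvdnP[q ->] : modulus b z %| \prod_(i <- s) modulus b i.
    by rewrite (big_rem z) //= dvdn_mulr.
  by exists q.
apply/negPn/negP => zs.
have /eqP : coprime (modulus b z) (\prod_(i <- s) modulus b i).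
  rewrite big_seq; apply: (big_ind (coprime (modulus b z))) => [|x y|i si].
  - exact: coprimen1.
  - by rewrite coprimeMr => -> ->.
  have zlem : z <= m by lia.
  case: (ltngtP z i) => [zi|iz|E]; last by rewrite E si in zs.
  - exact: coprime_moduli (le_m i si) zi.
  - by rewrite coprime_sym; apply: coprime_moduli iz => //; apply: le_m.
rewrite -qa /modulus gcdnMl => -[].
by have := fact_gt0 m.+1; rewrite -/b; nia.
Qed.

Lemma coded_finite a b m : exists s : seq nat, forall z,
  (exists d, d + z = m) /\ (exists q, q * (z.+1 * b).+1 = a) <-> z \in s.
Proof.
exists [seq z <- iota 0 m.+1 | modulus b z %| a] => z.
rewrite mem_filter mem_iota /=; split=> [[[d zm] [q qa]]|/andP[/dvdnP[q ->] zm]].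
  apply/andP; split; last by lia.
  by apply/dvdnP; exists q.
by split; [exists (m - z); lia | exists q].
Qed.

(** * Inductive sets *)
(** * Inductively defined sets *)
(** The semantic counterpart of [oInd], with finite sets as lists. *)
Definition Ind (step : (nat -> Prop) -> nat -> Prop) (n : nat) :=
  exists s : seq nat, n \in s /\ forall z, z \in s -> step (fun y => y \in s) z.

(** Phi is monotone, and each instance of it depends on finitely many elements.
All the clauses below have this form, and it is what makes finite witnesses
sufficient: see [Ind_fix]. *)
Definition finitary (Phi : (nat -> Prop) -> Prop) := forall S, Phi S ->
  exists l : seq nat, (forall y, y \in l -> S y) /\
    forall S', (forall y, y \in l -> S' y) -> Phi S'.

Lemma finitary_mono Phi S S' : finitary Phi -> (forall y, S y -> S' y) ->
  Phi S -> Phi S'.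
Proof. by move=> fPhi SS' /fPhi[l [lS]]; apply=> y /lS /SS'. Qed.

Lemma fin_const P : finitary (fun _ => P).
Proof. by move=> S p; exists [::]. Qed.

Lemma fin_atom n : finitary (fun S => S n).
Proof.
move=> S Sn; exists [:: n]; split => [y|S']; first by rewrite inE => /eqP->.
by apply; rewrite inE.
Qed.

Lemma fin_and P Q : finitary P -> finitary Q -> finitary (fun S => P S /\ Q S).
Proof.
move=> fP fQ S [/fP[l [lS lP]] /fQ[l' [lS' lQ]]]; exists (l ++ l'); split.
  by move=> y; rewrite mem_cat => /orP[/lS|/lS'].
by move=> S' H; split; [apply: lP | apply: lQ] => y yl; apply: H; rewrite mem_cat yl ?orbT.
Qed.

Lemma fin_or P Q : finitary P -> finitary Q -> finitary (fun S => P S \/ Q S).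
Proof.
move=> fP fQ S [/fP|/fQ] [l [lS lP]]; exists l; split => // S' /lP; tauto.
Qed.

Lemma fin_ex T (P : T -> _) : (forall x, finitary (P x)) ->
  finitary (fun S => exists x, P x S).
Proof.
move=> fP S [x /fP[l [lS lP]]]; exists l; split => // S' /lP; by exists x.
Qed.

Ltac prove_finitary := repeat first [exact: fin_atom | apply: fin_or | apply: fin_and
  | apply: fin_ex => ? | exact: fin_const].

(** From right to left, the finitely many elements on which the step depends have
finite witnesses, whose union, with z added, is a witness for z.  Equations
derived from this lemma determine the set by recursion on expressions. *)
Lemma Ind_fix step : (forall z, finitary (step^~ z)) ->
  forall z, Ind step z <-> step (Ind step) z.
Proof.
move=> fstep z; split=> [[s [zs H]]|].
  have [l [ls lS]] := fstep _ _ (H z zs).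
  by apply: lS => y /ls ys; exists s.
move/fstep => [l [lI lS]].
have [s [ls sS]] : exists s : seq nat, {subset l <= s} /\
    forall z, z \in s -> step (fun y => y \in s) z.
  elim: l lI {lS} => [_|x l IH lI]; first by exists [::].
  have [|s [ls sS]] := IH; first by move=> y yl; apply: lI; rewrite inE yl orbT.
  have [|s' [xs sS']] := lI x; first by rewrite inE eqxx.
  exists (s' ++ s); split=> y.
    by rewrite inE mem_cat => /orP[/eqP->|/ls->]; rewrite ?xs ?orbT.
  rewrite mem_cat => /orP[/sS'|/sS] /fstep[l' [l's lS']];
    by apply: lS' => u /l's us; rewrite mem_cat us ?orbT.
exists (z :: s); split; first by rewrite inE eqxx.
move=> y; rewrite inE => /orP[/eqP->|/sS].
  by apply: lS => u /ls us; rewrite inE us orbT.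
by move=> /fstep[l' [l's lS']]; apply: lS' => u /l's us; rewrite inE us orbT.
Qed.

(** * Meaning of the formulas built level by level *)
(** A level k with the values of the variables; only those below k matter. *)
Definition world := (nat * env)%type.

Definition ext (w w' : world) := w.1 <= w'.1 /\ forall y, y < w.1 -> w'.2 y = w.2 y.

Definition den (w : world) (t : term) (n : nat) :=
  (forall y, y \in fvt t -> y < w.1) /\ eval w.2 t = n.

Lemma den_ext w w' t n : ext w w' -> den w t n -> den w' t n.
Proof.
move=> [ww' ee'] [tw <-]; split=> [y /tw yw|]; first exact: leq_trans ww'.
by apply: eval_agree => y /tw; apply: ee'.
Qed.

Lemma den_value w t m n : den w t m -> m = n -> den w t n.
Proof. by move=> d <-. Qed.

Lemma den_zero w : den w Zero 0.
Proof. by []. Qed.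

Lemma den_fn1 w f s m : den w s m -> den w (Fn1 f s) (interp1 f m).
Proof. by move=> [sw <-]. Qed.

Lemma den_fn2 w f s t m n : den w s m -> den w t n -> den w (Fn2 f s t) (interp2 f m n).
Proof.
move=> [sw <-] [tw <-]; split=> // y /=; rewrite mem_cat => /orP[]; [exact: sw|exact: tw].
Qed.

Lemma eval_numeral e n : eval e (numeral n) = n.
Proof. by elim: n => //= n ->. Qed.

Lemma fvt_numeral n : fvt (numeral n) = [::].
Proof. by elim: n. Qed.

Lemma den_numeral w n : den w (numeral n) n.
Proof. by split; rewrite ?eval_numeral // fvt_numeral. Qed.

Lemma den_pair w s t m n : den w s m -> den w t n -> den w (tpair s t) (cpair m n).
Proof. by move=> ds dt; apply: (den_fn2 fadd) => //; apply: (den_fn2 fmul); apply: (den_fn2 fadd). Qed.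

Section Holds.
Variables X Y : nat -> Prop.

(** At level w.1, the formula is equivalent to P.  The lemmas below compute P
from an [oform] by recursion; the binders of [oAll] and [oEx] yield a
denotation in an extended world, to which earlier denotations are transported. *)
Definition holds (w : world) (p : oform) (P : Prop) := sat X Y w.2 (p w.1) <-> P.

(** The quantification over later worlds lets R be used below further binders. *)
Definition rep (w : world) (R : term -> oform) (S : nat -> Prop) :=
  forall w' t n, ext w w' -> den w' t n -> holds w' (R t) (S n).

Lemma ext_trans w w' w'' : ext w w' -> ext w' w'' -> ext w w''.
Proof.
move=> [l e] [l' e']; split=> [|y yw]; first exact: leq_trans l'.
by rewrite e' ?e //; apply: leq_trans l.
Qed.

Lemma rep_ext w w' R S : ext w w' -> rep w R S -> rep w' R S.
Proof. by move=> ww' r w'' t n /(ext_trans ww'); apply: r. Qed.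

Lemma holds_rep w R S t n : rep w R S -> den w t n -> holds w (R t) (S n).
Proof. by move=> r; apply: r. Qed.

Lemma holds_eq w s t m n : den w s m -> den w t n -> holds w (oEq s t) (m = n).
Proof. by move=> [_ <-] [_ <-]; split=> /eqP. Qed.

Lemma holds_T w t n : den w t n -> holds w (oT t) (X n).
Proof. by move=> [_ <-]. Qed.

Lemma holds_D w t n : den w t n -> holds w (oD t) (Y n).
Proof. by move=> [_ <-]. Qed.

Lemma holds_neg w p P : holds w p P -> holds w (oNeg p) (~ P).
Proof. by rewrite /holds sat_neg => ->. Qed.

Lemma holds_and w p q P Q : holds w p P -> holds w q Q -> holds w (oAnd p q) (P /\ Q).
Proof. by rewrite /holds => <- <-. Qed.

Lemma holds_or w p q P Q : holds w p P -> holds w q Q -> holds w (oOr p q) (P \/ Q).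
Proof. by rewrite /holds => <- <-. Qed.

Lemma holds_imp w p q P Q : holds w p P -> holds w q Q -> holds w (oImp p q) (P -> Q).
Proof. by rewrite /holds => <- <-; apply: sat_imp. Qed.

Lemma holds_iff w p q P Q : holds w p P -> holds w q Q -> holds w (oIff p q) (P <-> Q).
Proof. by move=> hp hq; apply: holds_and; apply: holds_imp. Qed.

Lemma ext_upd (w : world) n : ext w (w.1.+1, upd w.2 w.1 n).
Proof. by split=> //= y; rewrite /upd; case: eqP => // ->; rewrite ltnn. Qed.

Lemma den_upd (w : world) n : den (w.1.+1, upd w.2 w.1 n) (Var w.1) n.
Proof. by split=> [y|] /=; rewrite /upd ?eqxx // inE => /eqP->. Qed.

Lemma holds_all w P Q :
  (forall w' x n, ext w w' -> den w' x n -> holds w' (P x) (Q n)) ->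
  holds w (oAll P) (forall n, Q n).
Proof.
move=> H; have {}H n := H _ _ _ (ext_upd w n) (den_upd w n).
by split=> HQ n; apply/H; apply: HQ.
Qed.

Lemma holds_ex w P Q :
  (forall w' x n, ext w w' -> den w' x n -> holds w' (P x) (Q n)) ->
  holds w (oEx P) (exists n, Q n).
Proof.
move=> H; have {}H n := H _ _ _ (ext_upd w n) (den_upd w n).
by split=> -[n HQ]; exists n; apply/H.
Qed.

Lemma holds_congr w p P Q : holds w p P -> (P <-> Q) -> holds w p Q.
Proof. by rewrite /holds => -> ->. Qed.
End Holds.

(** Moves all denotations from w to its extension w'. *)
Ltac transport w w' E :=
  repeat match goal with
  | H : den w _ _ |- _ => apply (den_ext E) in H
  | H : rep _ _ w _ _ |- _ => apply (rep_ext E) in H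
  end; clear E; try clear w.

(** c is an object-level constructor of codes with tag g. *)
Definition unary (c : term -> term) g :=
  forall w t n, den w t n -> den w (c t) (cpair g n).
Definition binary (c : term -> term -> term) g :=
  forall w s t m n, den w s m -> den w t n -> den w (c s t) (cpair g (cpair m n)).

Ltac denote_term := first [eassumption | exact: den_zero | exact: den_numeral
  | match goal with H : unary ?c _ |- den _ (?c _) _ => eapply H; denote_term
    | H : binary ?c _ |- den _ (?c _ _) _ => eapply H; denote_term end
  | eapply den_pair; denote_term | eapply den_fn1; denote_term | eapply den_fn2; denote_term].
Ltac denote := eapply den_value; [denote_term|reflexivity].

Ltac enter := let w := fresh "w" in let x := fresh "x" in
  let n := fresh "n" in let E := fresh "E" in let d := fresh "d" in
  intros w x n E d; match type of E with ext ?v _ => transport v w E end.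

(** The proposition in a goal [holds X Y w p P] may be an existential variable: it
is then read off from p. *)
Ltac interpret_step := lazymatch goal with
  | |- holds _ _ _ (oAll _) _ => eapply holds_all; enter
  | |- holds _ _ _ (oEx _) _ => eapply holds_ex; enter
  | |- holds _ _ _ (oIff _ _) _ => eapply holds_iff
  | |- holds _ _ _ (oImp _ _) _ => eapply holds_imp
  | |- holds _ _ _ (oOr _ _) _ => eapply holds_or
  | |- holds _ _ _ (oAnd _ _) _ => eapply holds_and
  | |- holds _ _ _ (oNeg _) _ => eapply holds_neg
  | |- holds _ _ _ (oEq _ _) _ => eapply holds_eq; denote
  | |- holds _ _ _ (oT _) _ => apply: holds_T; denote
  | |- holds _ _ _ (oD _) _ => apply: holds_D; denote
  | |- holds _ _ _ _ _ => eapply holds_rep; [eassumption|denote]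
  end.

(** * The syntactic relations and their arithmetization *)
Definition is_tag1 (g : nat) := g \in [seq tag1 f | f <- funs1] ++ [:: tag_T; tag_D; tag_neg].
Definition is_tag2 (g : nat) := g \in [seq tag2 f | f <- funs2] ++ [:: tag_eq; tag_and].

Definition term_step (S : nat -> Prop) z :=
  (exists n, z = cpair tag_var n) \/ z = cpair tag_zero 0 \/
  (exists f x, z = cpair (tag1 f) x /\ S x) \/
  (exists f x y, z = cpair (tag2 f) (cpair x y) /\ S x /\ S y).
Definition isTerm := Ind term_step.

Definition form_step (S : nat -> Prop) z :=
  (exists s t, z = cpair tag_eq (cpair s t) /\ isTerm s /\ isTerm t) \/
  (exists t, z = cpair tag_T t /\ isTerm t) \/
  (exists t, z = cpair tag_D t /\ isTerm t) \/
  (exists x, z = cpair tag_neg x /\ S x) \/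
  (exists x y, z = cpair tag_and (cpair x y) /\ S x /\ S y) \/
  (exists v x, z = cpair tag_all (cpair v x) /\ S x).
Definition isForm := Ind form_step.

Definition free_step v (S : nat -> Prop) z :=
  z = cpair tag_var v \/
  (exists g, is_tag1 g /\ exists x, z = cpair g x /\ S x) \/
  (exists g, is_tag2 g /\ exists x y, z = cpair g (cpair x y) /\ (S x \/ S y)) \/
  (exists u x, z = cpair tag_all (cpair u x) /\ u <> v /\ S x).
Definition Free v := Ind (free_step v).

Definition subst_step v t (S : nat -> Prop) z := exists x y, z = cpair x y /\
  ((x = cpair tag_var v /\ y = t) \/
   (exists u, x = cpair tag_var u /\ u <> v /\ y = x) \/
   (x = cpair tag_zero 0 /\ y = x) \/
   (exists g, is_tag1 g /\ exists x1 y1,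
      x = cpair g x1 /\ y = cpair g y1 /\ S (cpair x1 y1)) \/
   (exists g, is_tag2 g /\ exists x1 x2 y1 y2,
      x = cpair g (cpair x1 x2) /\ y = cpair g (cpair y1 y2) /\
      S (cpair x1 y1) /\ S (cpair x2 y2)) \/
   (exists x1, x = cpair tag_all (cpair v x1) /\ y = x) \/
   (exists u x1 y1, x = cpair tag_all (cpair u x1) /\ u <> v /\
      y = cpair tag_all (cpair u y1) /\ S (cpair x1 y1))).
Definition Subst v t p q := Ind (subst_step v t) (cpair p q).

Definition val_step (S : nat -> Prop) z := exists x y, z = cpair x y /\
  ((x = cpair tag_zero 0 /\ y = 0) \/
   (exists f x1 y1, x = cpair (tag1 f) x1 /\ y = interp1 f y1 /\ S (cpair x1 y1)) \/
   (exists f x1 x2 y1 y2,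
      x = cpair (tag2 f) (cpair x1 x2) /\ y = interp2 f y1 y2 /\
      S (cpair x1 y1) /\ S (cpair x2 y2))).
Definition Val t w := Ind val_step (cpair t w).

Section Clauses.
Variables X Y : nat -> Prop.
Notation holds := (holds X Y).
Notation rep := (rep X Y).

Definition mem a b m z :=
  (exists d, d + z = m) /\ (exists q, q * (z.+1 * b).+1 = a).

Lemma rep_mem w a b m na nb nm : den w a na -> den w b nb -> den w m nm ->
  rep w (oMem a b m) (mem na nb nm).
Proof.
move=> da db dm w' t n E dt; transport w w' E.
apply: holds_and; apply: holds_ex; enter; apply: holds_eq => //.
  exact: (den_fn2 fadd).
exact: (den_fn2 fmul d (den_fn1 fsuc (den_fn2 fmul (den_fn1 fsuc dt) db))).
Qed.

(** Finite sets and triples (a, b, m) are interchangeable, because the step only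
depends on the extension of the set. *)
Lemma holds_ind w step Step x n :
  (forall z, finitary (Step^~ z)) ->
  (forall w' R S z k, ext w w' -> rep w' R S -> den w' z k ->
     holds w' (step R z) (Step S k)) ->
  den w x n -> holds w (oInd step x) (Ind Step n).
Proof.
move=> fStep H dx.
apply: (@holds_congr _ _ _ _ (exists a b m, mem a b m n /\
  forall z, mem a b m z -> Step (mem a b m) z)).
  apply: holds_ex => w1 a na E1 da; apply: holds_ex => w2 b nb E2 db.
  apply: holds_ex => w3 m nm E3 dm.
  have {}E1 := ext_trans (ext_trans E1 E2) E3.
  have {}da := den_ext (ext_trans E2 E3) da.
  have {E2}dx := den_ext E1 dx; have {E3}db := den_ext E3 db.
  have mem_ok := rep_mem da db dm.
  apply: holds_and; first exact: mem_ok.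
  apply: holds_all => w' z k E dz; apply: holds_imp; first exact: mem_ok.
  by apply: H => //; [exact: ext_trans E | exact: rep_ext mem_ok].
split=> [[a [b [m [nm St]]]]|[s [ns St]]].
  have [s sE] := coded_finite a b m; exists s; split; first exact/sE.
  by move=> z /sE /St; apply: (finitary_mono (fStep z)) => y /sE.
have [a [b [m sE]]] := code_finite s; exists a, b, m; split; first exact/sE.
by move=> z /sE /St; apply: (finitary_mono (fStep z)) => y /sE.
Qed.

Lemma ors_one w p P : holds w p P -> holds w (oOrs [:: p]) P.
Proof.
move=> hp; apply: holds_congr (holds_or hp _) _; first by apply: holds_eq; denote.
by split=> [[]|]; auto.
Qed.

Lemma ors_cons w p ps P Q : holds w p P -> holds w (oOrs ps) Q ->
  holds w (oOrs (p :: ps)) (P \/ Q).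
Proof. exact: holds_or. Qed.

Lemma sat_ors w ps : sat X Y w.2 (oOrs ps w.1) <-> List.Exists (fun p => sat X Y w.2 (p w.1)) ps.
Proof.
elim: ps => [|p ps IH].
  split=> [|H]; last by inversion H.
  by move=> /eqP.
rewrite List.Exists_cons -IH; apply: holds_or => //.
Qed.

Lemma ors_cat w ps qs P Q : holds w (oOrs ps) P -> holds w (oOrs qs) Q ->
  holds w (oOrs (ps ++ qs)) (P \/ Q).
Proof. by rewrite /holds !sat_ors List.Exists_app => -> ->. Qed.

Lemma ors_map A B w (F : A -> oform) (r : A -> B -> Prop) xs ys Q :
  List.Forall2 r xs ys ->
  (forall x y, List.In y ys -> r x y -> holds w (F x) (Q y)) ->
  holds w (oOrs (map F xs)) (exists y, List.In y ys /\ Q y).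
Proof.
rewrite /holds sat_ors => H.
elim: H => {xs ys} [|x y xs ys xy _ IH] Hr.
  by split=> [H|[y []//]]; inversion H.
rewrite List.Exists_cons (Hr x y) ?IH //.
- split=> [[Qy|[z [zs Qz]]]|[z [[<-|zs] Qz]]]; eauto.
  + by exists y; split => //; left.
  + by exists z; split => //; right.
- by move=> u v vs; apply: Hr; right.
- by left.
Qed.

Lemma ors_funs1 w F Q : (forall f, holds w (F f) (Q f)) ->
  holds w (oOrs (map F funs1)) (exists f, Q f).
Proof.
move=> H; apply: (@holds_congr _ _ _ _ (exists f, List.In f funs1 /\ Q f)).
  apply: (@ors_map _ _ _ _ eq) => [|f _ _ <- //].
  by elim: funs1 => [|f fs IH]; constructor.
split=> [[f [_ Qf]]|[f Qf]]; exists f => //.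
by split=> //; case: f {Qf}; rewrite /=; tauto.
Qed.

Lemma ors_funs2 w F Q : (forall f, holds w (F f) (Q f)) ->
  holds w (oOrs (map F funs2)) (exists f, Q f).
Proof.
move=> H; apply: (@holds_congr _ _ _ _ (exists f, List.In f funs2 /\ Q f)).
  apply: (@ors_map _ _ _ _ eq) => [|f _ _ <- //].
  by elim: funs2 => [|f fs IH]; constructor.
split=> [[f [_ Qf]]|[f Qf]]; exists f => //.
by split=> //; case: f {Qf}; rewrite /=; tauto.
Qed.

Lemma mem_In (s : seq nat) x : x \in s <-> List.In x s.
Proof.
elim: s => //= y s <-; rewrite inE; split=> [/orP[/eqP->|]|[->|->]]; auto.
  by rewrite eqxx.
by rewrite orbT.
Qed.

Lemma ors_ops1 w F (Q : nat -> Prop) : (forall c g, is_tag1 g -> unary c g -> holds w (F c) (Q g)) ->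
  holds w (oOrs (map F ops1)) (exists g, is_tag1 g /\ Q g).
Proof.
move=> H; apply: (@holds_congr _ _ _ _ (exists g, List.In g
  ([seq tag1 f | f <- funs1] ++ [:: tag_T; tag_D; tag_neg]) /\ Q g)); last first.
  by split=> -[g [/mem_In H1 H2]]; exists g; split => //; apply/mem_In.
apply: (@ors_map _ nat _ _ unary) => [|c g /mem_In]; last exact: H.
rewrite /ops1 /=; repeat apply: List.Forall2_cons; last exact: List.Forall2_nil.
all: by move=> v t n d; denote.
Qed.

Lemma ors_ops2 w F (Q : nat -> Prop) : (forall c g, is_tag2 g -> binary c g -> holds w (F c) (Q g)) ->
  holds w (oOrs (map F ops2)) (exists g, is_tag2 g /\ Q g).
Proof.
move=> H; apply: (@holds_congr _ _ _ _ (exists g, List.In g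
  ([seq tag2 f | f <- funs2] ++ [:: tag_eq; tag_and]) /\ Q g)); last first.
  by split=> -[g [/mem_In H1 H2]]; exists g; split => //; apply/mem_In.
apply: (@ors_map _ nat _ _ binary) => [|c g /mem_In]; last exact: H.
rewrite /ops2 /=; repeat apply: List.Forall2_cons; last exact: List.Forall2_nil.
all: by move=> v s t m n ds dt; denote.
Qed.

End Clauses.

Ltac interpret_clause := lazymatch goal with
  | |- holds _ _ _ (oOrs [:: _]) _ => apply: ors_one
  | |- holds _ _ _ (oOrs ((?a :: ?l) ++ ?r)) _ =>
      change ((a :: l) ++ r) with (a :: (l ++ r))
  | |- holds _ _ _ (oOrs ([::] ++ ?r)) _ => change ([::] ++ r) with r
  | |- holds _ _ _ (oOrs (_ ++ _)) _ => apply: ors_cat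
  | |- holds _ _ _ (oOrs (_ :: _)) _ => apply: ors_cons
  | |- holds _ _ _ (oOrs (map _ funs1)) _ => apply: ors_funs1 => ?
  | |- holds _ _ _ (oOrs (map _ funs2)) _ => apply: ors_funs2 => ?
  | |- holds _ _ _ (oOrs (map _ ops1)) _ => apply: ors_ops1 => ? ? ? ?
  | |- holds _ _ _ (oOrs (map _ ops2)) _ => apply: ors_ops2 => ? ? ? ?
  | _ => interpret_step
  end.

(** Proves the premise of [holds_ind] on steps. *)
Ltac interpret_clauses := let w' := fresh "w" in let E := fresh "E" in
  intros w' ? ? ? ? E ? ?;
  match type of E with ext ?w _ => transport w w' E end;
  repeat interpret_clause.

Section SyntacticRelations.
Variables X Y : nat -> Prop.
Notation holds := (holds X Y).

Lemma holds_Term w x n : den w x n -> holds w (oTerm x) (isTerm n).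
Proof.
move=> dx; apply: holds_ind (dx) => [z|]; first by rewrite /term_step; prove_finitary.
by rewrite /term_step; interpret_clauses.
Qed.

Lemma holds_Form w x n : den w x n -> holds w (oForm x) (isForm n).
Proof.
move=> dx; apply: holds_ind (dx) => [z|]; first by rewrite /form_step; prove_finitary.
by rewrite /form_step; interpret_clauses; apply: holds_Term; denote.
Qed.

Lemma holds_Free w v x m n : den w v m -> den w x n ->
  holds w (oFree v x) (Free m n).
Proof.
move=> dv dx; apply: holds_ind (dx) => [z|]; first by rewrite /free_step; prove_finitary.
by rewrite /free_step; interpret_clauses.
Qed.

Lemma holds_Subst w v t p q nv nt np nq : den w v nv -> den w t nt ->
  den w p np -> den w q nq -> holds w (oSubst v t p q) (Subst nv nt np nq).
Proof.
move=> dv dt dp dq; apply: holds_ind (den_pair dp dq) => [z|].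
  by rewrite /subst_step; prove_finitary.
by rewrite /subst_step; interpret_clauses.
Qed.

Lemma holds_Val w t v nt nv : den w t nt -> den w v nv ->
  holds w (oVal t v) (Val nt nv).
Proof.
move=> dt dv; apply: holds_ind (den_pair dt dv) => [z|].
  by rewrite /val_step; prove_finitary.
by rewrite /val_step; interpret_clauses.
Qed.
End SyntacticRelations.

(** * The coded relations are the intended ones *)
Ltac split_codes_once := repeat match goal with
  | H : exists _, _ |- _ => destruct H
  | H : _ /\ _ |- _ => destruct H
  | H : _ \/ _ |- _ => destruct H
  | H : cpair _ _ = cpair _ _ |- _ => apply cpair_inj in H; destruct H
  end; subst.
Ltac split_codes := repeat (progress split_codes_once).

Lemma isTerm_fix z : isTerm z <-> term_step isTerm z.
Proof. by apply: Ind_fix => {}z; rewrite /term_step; prove_finitary. Qed.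
Lemma isForm_fix z : isForm z <-> form_step isForm z.
Proof. by apply: Ind_fix => {}z; rewrite /form_step; prove_finitary. Qed.
Lemma Free_fix v z : Free v z <-> free_step v (Free v) z.
Proof. by apply: Ind_fix => {}z; rewrite /free_step; prove_finitary. Qed.
Lemma Subst_fix v t p q : Subst v t p q <-> subst_step v t (Ind (subst_step v t)) (cpair p q).
Proof. by apply: Ind_fix => {}z; rewrite /subst_step; prove_finitary. Qed.
Lemma Val_fix t w : Val t w <-> val_step (Ind val_step) (cpair t w).
Proof. by apply: Ind_fix => {}z; rewrite /val_step; prove_finitary. Qed.

(** Strong induction on the code recovers the term. *)
Lemma isTermP n : isTerm n <-> exists t, n = code_term t.
Proof.
split=> [|[t ->]]; last first.
  elim: t => /= [n'||f t IH|f t IHt u IHu]; apply/isTerm_fix.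
  - by left; exists n'.
  - by right; left.
  - by do 2 right; left; exists f, (code_term t).
  - by do 3 right; exists f, (code_term t), (code_term u).
elim/ltn_ind: n => n IH /isTerm_fix [[m ->]|[->|[[f [x [E Tx]]]|[f [x [y [E [Tx Ty]]]]]]]].
- by exists (Var m).
- by exists Zero.
- have [|t Et] := IH x _ Tx; first by rewrite E cpair_gt0 //; case: f {E}.
  by exists (Fn1 f t); rewrite E Et.
- have lt : cpair x y < n by rewrite E cpair_gt0 //; case: f {E}.
  have [|t Et] := IH x _ Tx; first exact: leq_ltn_trans (cpair_gel x y) lt.
  have [|u Eu] := IH y _ Ty; first exact: leq_ltn_trans (cpair_ger x y) lt.
  by exists (Fn2 f t u); rewrite E Et Eu.
Qed.

Lemma isFormP n : isForm n <-> exists p, n = code p.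
Proof.
have T t : isTerm (code_term t) by apply/isTermP; exists t.
split=> [|[p ->]]; last first.
  elim: p => /= [s t|t|t|p IH|p IHp q IHq|x p IH]; apply/isForm_fix.
  - by left; exists (code_term s), (code_term t).
  - by right; left; exists (code_term t).
  - by do 2 right; left; exists (code_term t).
  - by do 3 right; left; exists (code p).
  - by do 4 right; left; exists (code p), (code q).
  - by do 5 right; exists x, (code p).
elim/ltn_ind: n => n IH /isForm_fix.
case=> [[x [y [E [/isTermP[s Es] /isTermP[t Et]]]]]|].
  by exists (FEq s t); rewrite E Es Et.
case=> [[x [E /isTermP[t Et]]]|]; first by exists (FT t); rewrite E Et.
case=> [[x [E /isTermP[t Et]]]|]; first by exists (FD t); rewrite E Et.
case=> [[x [E Fx]]|].
  have [|p Ep] := IH x _ Fx; first by rewrite E cpair_gt0.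
  by exists (FNeg p); rewrite E Ep.
case=> [[x [y [E [Fx Fy]]]]|[v [x [E Fx]]]].
  have lt : cpair x y < n by rewrite E cpair_gt0.
  have [|p Ep] := IH x _ Fx; first exact: leq_ltn_trans (cpair_gel x y) lt.
  have [|q Eq] := IH y _ Fy; first exact: leq_ltn_trans (cpair_ger x y) lt.
  by exists (FAnd p q); rewrite E Ep Eq.
have lt : cpair v x < n by rewrite E cpair_gt0.
have [|p Ep] := IH x _ Fx; first exact: leq_ltn_trans (cpair_ger v x) lt.
by exists (FAll v p); rewrite E Ep.
Qed.

(** Hence, for each of the inductive definitions, only the clause with the
matching tag applies to a given code. *)
Lemma tags_disjoint g : is_tag1 g -> is_tag2 g -> False.
Proof. by move=> g1; apply/negP; move: g g1; apply/allP. Qed.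

Ltac decode_step := split_codes; try done;
  try solve [exfalso; eapply tags_disjoint; eassumption].

Section Free.
Variable v : nat.

Lemma Free_var n : Free v (cpair tag_var n) <-> n = v.
Proof.
rewrite Free_fix; split=> [H|->]; last by left.
by rewrite /free_step in H; decode_step.
Qed.

Lemma Free_zero : ~ Free v (cpair tag_zero 0).
Proof. by rewrite Free_fix /free_step => H; decode_step. Qed.

Lemma Free_op1 g x : is_tag1 g -> Free v (cpair g x) <-> Free v x.
Proof.
move=> g1; rewrite Free_fix; split=> [H|H]; last by right; left; exists g; split => //; exists x.
by rewrite /free_step in H; decode_step.
Qed.

Lemma Free_op2 g x y : is_tag2 g -> Free v (cpair g (cpair x y)) <-> Free v x \/ Free v y.
Proof.
move=> g2; rewrite Free_fix; split=> [H|H].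
  by rewrite /free_step in H; decode_step; auto.
by do 2 right; left; exists g; split => //; exists x, y.
Qed.

Lemma Free_all u x : Free v (cpair tag_all (cpair u x)) <-> u <> v /\ Free v x.
Proof.
rewrite Free_fix; split=> [H|H]; last by do 3 right; exists u, x.
by rewrite /free_step in H; decode_step.
Qed.

Lemma is_tag1_tag1 f : is_tag1 (tag1 f). Proof. by case: f. Qed.
Lemma is_tag2_tag2 f : is_tag2 (tag2 f). Proof. by case: f. Qed.

Lemma Free_term t : Free v (code_term t) <-> v \in fvt t.
Proof.
elim: t => /= [n||f t IH|f t IHt u IHu].
- by rewrite Free_var inE; split=> [->|/eqP->].
- by split=> // /Free_zero.
- by rewrite Free_op1 ?is_tag1_tag1.
- rewrite Free_op2 ?is_tag2_tag2 // IHt IHu mem_cat.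
  by split=> [/orP|/orP].
Qed.

Lemma Free_form p : Free v (code p) <-> v \in fv p.
Proof.
elim: p => /= [s t|t|t|p IH|p IHp q IHq|x p IH].
- by rewrite Free_op2 // !Free_term mem_cat; split=> /orP.
- by rewrite Free_op1 // Free_term.
- by rewrite Free_op1 // Free_term.
- by rewrite Free_op1.
- by rewrite Free_op2 // IHp IHq mem_cat; split=> /orP.
- rewrite Free_all IH mem_filter; split=> [[/eqP xv ->]|/andP[vx ->]].
    by rewrite eq_sym xv.
  by split=> //; apply/eqP; rewrite eq_sym.
Qed.
End Free.

Section Subst.
Variables v c : nat.

Lemma Subst_var n q : Subst v c (cpair tag_var n) q <->
  q = if n == v then c else cpair tag_var n.
Proof.
rewrite Subst_fix /subst_step; split=> [H|->].
  by decode_step; rewrite ?eqxx //; case: eqP.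
exists (cpair tag_var n); eexists; split; first by [].
case: eqP => [->|nv]; first by left.
by right; left; exists n.
Qed.

Lemma Subst_zero q : Subst v c (cpair tag_zero 0) q <-> q = cpair tag_zero 0.
Proof.
rewrite Subst_fix /subst_step; split=> [H|->]; first by decode_step.
by do 2 eexists; split=> //; do 2 right; left.
Qed.

Lemma Subst_op1 g x q : is_tag1 g ->
  Subst v c (cpair g x) q <-> exists y, q = cpair g y /\ Subst v c x y.
Proof.
move=> g1; rewrite Subst_fix /subst_step; split=> [H|[y [-> H]]].
  by decode_step; eauto.
by do 2 eexists; split=> //; do 3 right; left; exists g; split=> //; exists x, y.
Qed.

Lemma Subst_op2 g x1 x2 q : is_tag2 g -> Subst v c (cpair g (cpair x1 x2)) q <->
  exists y1 y2, q = cpair g (cpair y1 y2) /\ Subst v c x1 y1 /\ Subst v c x2 y2.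
Proof.
move=> g2; rewrite Subst_fix /subst_step; split=> [H|[y1 [y2 [-> H]]]].
  by decode_step; do 2 eexists; eauto.
by do 2 eexists; split=> //; do 4 right; left; exists g; split=> //; exists x1, x2, y1, y2.
Qed.

Lemma Subst_all u x q : Subst v c (cpair tag_all (cpair u x)) q <->
  if u == v then q = cpair tag_all (cpair u x)
  else exists y, q = cpair tag_all (cpair u y) /\ Subst v c x y.
Proof.
rewrite Subst_fix /subst_step; split=> [H|].
  by decode_step; rewrite ?eqxx //; case: eqP => // _; eauto.
case: eqP => [-> ->|uv [y [-> H]]]; do 2 eexists; split=> //.
  by do 5 right; left; exists x.
by do 6 right; exists u, x, y.
Qed.
End Subst.

Lemma Subst_term v s t q : Subst v (code_term s) (code_term t) q <->
  q = code_term (substt v s t).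
Proof.
elim: t q => /= [n||f t IH|f t IHt u IHu] q.
- by rewrite Subst_var; case: eqP.
- exact: Subst_zero.
- rewrite Subst_op1 ?is_tag1_tag1 //; split=> [[y [-> /IH->]] //|->].
  by eexists; split; last exact/IH.
- rewrite Subst_op2 ?is_tag2_tag2 //; split=> [[y [z [-> [/IHt-> /IHu->]]]] //|->].
  by do 2 eexists; split; last by split; [exact/IHt|exact/IHu].
Qed.

Lemma Subst_form v s p q : Subst v (code_term s) (code p) q <->
  q = code (subst v s p).
Proof.
elim: p q => /= [t u|t|t|p IH|p IHp r IHr|x p IH] q.
- rewrite Subst_op2 //; split=> [[y [z [-> [/Subst_term-> /Subst_term->]]]] //|->].
  by do 2 eexists; split; last by split; exact/Subst_term.
- rewrite Subst_op1 //; split=> [[y [-> /Subst_term->]] //|->].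
  by eexists; split; last exact/Subst_term.
- rewrite Subst_op1 //; split=> [[y [-> /Subst_term->]] //|->].
  by eexists; split; last exact/Subst_term.
- rewrite Subst_op1 //; split=> [[y [-> /IH->]] //|->].
  by eexists; split; last exact/IH.
- rewrite Subst_op2 //; split=> [[y [z [-> [/IHp-> /IHr->]]]] //|->].
  by do 2 eexists; split; last by split; [exact/IHp|exact/IHr].
- rewrite Subst_all; case: ifP => //= _.
  split=> [[y [-> /IH->]] //|->].
  by eexists; split; last exact/IH.
Qed.

Lemma tag1_inj : injective tag1. Proof. by do 2 case. Qed.
Lemma tag2_inj : injective tag2. Proof. by do 2 case. Qed.
Lemma tag12 f g : tag1 f <> tag2 g. Proof. by case: f; case: g. Qed.

Lemma Val_zero w : Val (cpair tag_zero 0) w <-> w = 0.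
Proof.
rewrite Val_fix /val_step; split=> [|->]; last by do 2 eexists; split=> //; left.
case=> x [y [/cpair_inj[<- <-] [[_ ->] //|[]]]].
- by case=> f [x1 [y1 [/cpair_inj[]]]]; case: f.
- by case=> f [x1 [x2 [y1 [y2 [/cpair_inj[]]]]]]; case: f.
Qed.

Lemma Val_fn1 f x w : Val (cpair (tag1 f) x) w <-> exists y, w = interp1 f y /\ Val x y.
Proof.
rewrite Val_fix /val_step; split=> [|[y [-> H]]]; last first.
  by do 2 eexists; split=> //; right; left; exists f, x, y.
case=> x0 [y [/cpair_inj[<- <-] [[/cpair_inj[]]|[]]]]; first by case: f.
- by case=> f' [x1 [y1 [/cpair_inj[/tag1_inj<- <-] H]]]; exists y1.
- by case=> f' [x1 [x2 [y1 [y2 [/cpair_inj[/tag12]]]]]].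
Qed.

Lemma Val_fn2 f x1 x2 w : Val (cpair (tag2 f) (cpair x1 x2)) w <->
  exists y1 y2, w = interp2 f y1 y2 /\ Val x1 y1 /\ Val x2 y2.
Proof.
rewrite Val_fix /val_step; split=> [|[y1 [y2 [-> H]]]]; last first.
  by do 2 eexists; split=> //; right; right; exists f, x1, x2, y1, y2.
case=> x0 [y [/cpair_inj[<- <-] [[/cpair_inj[]]|[]]]]; first by case: f.
- by case=> f' [? [? [/cpair_inj[/esym/tag12]]]].
- case=> f' [? [? [y1 [y2 [/cpair_inj[/tag2_inj<- /cpair_inj[<- <-]] H]]]]].
  by exists y1, y2.
Qed.

Lemma Val_term e t w : fvt t = [::] -> Val (code_term t) w <-> w = eval e t.
Proof.
elim: t w => //= [|f t IH|f t IHt u IHu] w.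
- by move=> _; apply: Val_zero.
- move=> /IH{}IH; rewrite Val_fn1; split=> [[y [-> /IH->]] //|->].
  by eexists; split; last exact/IH.
- move=> ctu; have {}IHt w' := IHt w' _; have {}IHu w' := IHu w' _.
  have [ct cu] : fvt t = [::] /\ fvt u = [::] by case: (fvt t) ctu.
  rewrite Val_fn2; split=> [[y [z [-> [/IHt-> // /IHu-> //]]]]|->].
  by do 2 eexists; split; last by split; [exact/IHt|exact/IHu].
Qed.

(** * Quantifiers over terms, sentences and formulas *)
Lemma code_term_inj : injective code_term.
Proof.
elim=> [m||f s IH|f s IHs u IHu] [n||g t|g t v] //= /cpair_inj[] //.
all: try by [case: f | case: g].
- by move=> _ ->.
- by move/tag1_inj=> -> /IH->.
- by move/tag12.
- by move/esym/tag12.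
- by move/tag2_inj=> -> /cpair_inj[/IHs-> /IHu->].
Qed.

Lemma code_inj : injective code.
Proof.
elim=> [s t|t|t|p IH|p IHp q IHq|x p IH] [s' t'|t'|t'|p'|p' q'|x' p'] //= /cpair_inj[] // _.
- by case/cpair_inj=> /code_term_inj-> /code_term_inj->.
- by move/code_term_inj->.
- by move/code_term_inj->.
- by move/IH->.
- by case/cpair_inj=> /IHp-> /IHq->.
- by case/cpair_inj=> -> /IH->.
Qed.

Definition env0 : env := fun _ => 0.
Definition closed_term t := fvt t = [::].
Definition closed p := fv p = [::].
Definition unary_in (v : nat) p := forall u : nat, u \in fv p -> u = v.

Lemma nilP (s : seq nat) : s = [::] <-> forall x, x \notin s.
Proof.
split=> [-> //|]; case: s => // x s H.
by move: (H x); rewrite inE eqxx.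
Qed.

Section Quantifiers.
Variables X Y : nat -> Prop.
Notation holds := (holds X Y).

(** The meaning of q may depend on P: a guard such as [oSent x] is what allows the
value of x to be written as the code of a sentence. *)
Lemma holds_imp_dep w p q P Q : holds w p P -> (P -> holds w q Q) ->
  holds w (oImp p q) (P -> Q).
Proof.
rewrite /holds => <- H; have := sat_imp X Y w.2 (p w.1) (q w.1).
by rewrite /oImp /oNeg /oAnd /FImp; tauto.
Qed.

Lemma holds_and_dep w p q P Q : holds w p P -> (P -> holds w q Q) ->
  holds w (oAnd p q) (P /\ Q).
Proof. by rewrite /holds => <- H; split=> -[Hp Hq]; split=> //; apply/H. Qed.

Lemma holds_ClTerm w x n : den w x n ->
  holds w (oClTerm x) (exists t, closed_term t /\ n = code_term t).
Proof.
move=> dx; apply: (@holds_congr _ _ _ _ (isTerm n /\ forall v, ~ Free v n)).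
  apply: holds_and; first exact: holds_Term.
  by apply: holds_all; enter; apply: holds_neg; apply: holds_Free.
split=> [[/isTermP[t ->] H]|[t [ct ->]]].
  by exists t; split=> //; apply/nilP => v; apply/negP => /Free_term /H.
by split=> [|v]; [apply/isTermP; exists t | rewrite Free_term ct].
Qed.

Lemma holds_Sent w x n : den w x n ->
  holds w (oSent x) (exists p, closed p /\ n = code p).
Proof.
move=> dx; apply: (@holds_congr _ _ _ _ (isForm n /\ forall v, ~ Free v n)).
  apply: holds_and; first exact: holds_Form.
  by apply: holds_all; enter; apply: holds_neg; apply: holds_Free.
split=> [[/isFormP[t ->] H]|[t [ct ->]]].
  by exists t; split=> //; apply/nilP => v; apply/negP => /Free_form /H.
by split=> [|v]; [apply/isFormP; exists t | rewrite Free_form ct].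
Qed.

Lemma holds_Form1 w v x m n : den w v m -> den w x n ->
  holds w (oForm1 v x) (exists p, unary_in m p /\ n = code p).
Proof.
move=> dv dx.
apply: (@holds_congr _ _ _ _ (isForm n /\ forall u, Free u n -> u = m)).
  apply: holds_and; first exact: holds_Form.
  apply: holds_all; enter; apply: holds_imp; first exact: holds_Free.
  by apply: holds_eq.
split=> [[/isFormP[p ->] H]|[p [up ->]]].
  by exists p; split=> // u /Free_form /H.
by split=> [|u /Free_form /up //]; apply/isFormP; exists p.
Qed.

(** Quantification over codes becomes quantification over expressions; codes
determine them by injectivity. *)
Lemma holds_allTerm w P Q :
  (forall w' x t, ext w w' -> closed_term t -> den w' x (code_term t) ->
     holds w' (P x) (Q t)) ->
  holds w (allTerm P) (forall t, closed_term t -> Q t).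
Proof.
move=> H; apply: (@holds_congr _ _ _ _ (forall n,
  (exists t, closed_term t /\ n = code_term t) -> forall t, n = code_term t -> Q t)).
  apply: holds_all => w' x n E dx; apply: holds_imp_dep; first exact: holds_ClTerm.
  case=> t [ct En]; rewrite En in dx *; apply: holds_congr (H _ _ _ E ct dx) _.
  by split=> [Qt u /code_term_inj <-|]; auto.
by split=> [Q' t ct|Q' _ [t [ct ->]] _ /code_term_inj <-]; eauto.
Qed.

Lemma holds_exTerm w P Q :
  (forall w' x t, ext w w' -> closed_term t -> den w' x (code_term t) ->
     holds w' (P x) (Q t)) ->
  holds w (exTerm P) (exists t, closed_term t /\ Q t).
Proof.
move=> H; apply: (@holds_congr _ _ _ _ (exists n,
  (exists t, closed_term t /\ n = code_term t) /\ forall t, n = code_term t -> Q t)).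
  apply: holds_ex => w' x n E dx; apply: holds_and_dep; first exact: holds_ClTerm.
  case=> t [ct En]; rewrite En in dx *; apply: holds_congr (H _ _ _ E ct dx) _.
  by split=> [Qt u /code_term_inj <-|]; auto.
split=> [[_ [[t [ct ->]] Qt]]|[t [ct Qt]]]; first by exists t; auto.
by exists (code_term t); split=> [|_ /code_term_inj <-] //; exists t.
Qed.

Lemma holds_allSent w P Q :
  (forall w' x p, ext w w' -> closed p -> den w' x (code p) ->
     holds w' (P x) (Q p)) ->
  holds w (allSent P) (forall p, closed p -> Q p).
Proof.
move=> H; apply: (@holds_congr _ _ _ _ (forall n,
  (exists p, closed p /\ n = code p) -> forall p, n = code p -> Q p)).
  apply: holds_all => w' x n E dx; apply: holds_imp_dep; first exact: holds_Sent.
  case=> t [ct En]; rewrite En in dx *; apply: holds_congr (H _ _ _ E ct dx) _.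
  by split=> [Qt u /code_inj <-|]; auto.
by split=> [Q' t ct|Q' _ [t [ct ->]] _ /code_inj <-]; eauto.
Qed.

Lemma holds_allForm1 w P Q :
  (forall w' v x n p, ext w w' -> unary_in n p -> den w' v n -> den w' x (code p) ->
     holds w' (P v x) (Q n p)) ->
  holds w (allForm1 P) (forall n p, unary_in n p -> Q n p).
Proof.
move=> H; apply: (@holds_congr _ _ _ _ (forall m n,
  (exists p, unary_in m p /\ n = code p) -> forall p, n = code p -> Q m p)).
  apply: holds_all => w1 v m E1 dv; apply: holds_all => w' x n E2 dx.
  have {E1}E := ext_trans E1 E2; have {E2}dv := den_ext E2 dv.
  apply: holds_imp_dep; first exact: holds_Form1.
  case=> p [up En]; rewrite En in dx *; apply: holds_congr (H _ _ _ _ _ E up dv dx) _.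
  by split=> [Qt u /code_inj <-|]; auto.
by split=> [Q' n p up|Q' m _ [p [up ->]] _ /code_inj <-]; eauto.
Qed.

Lemma holds_atVal w x t P Q : den w x (code_term t) -> closed_term t ->
  (forall w' y, ext w w' -> den w' y (eval env0 t) -> holds w' (P y) Q) ->
  holds w (atVal x P) Q.
Proof.
move=> dx ct H; apply: (@holds_congr _ _ _ _ (exists n, Val (code_term t) n /\ Q)).
  apply: holds_ex => w' y n E dy; apply: holds_and_dep.
    by apply: holds_Val => //; apply: den_ext dx.
  by move=> /(Val_term env0 _ ct) En; apply: H => //; rewrite -En.
split=> [[n []] //|HQ]; exists (eval env0 t); split=> //; exact/Val_term.
Qed.

Lemma holds_atSubst w p x v f t n P Q :
  den w p (code f) -> den w x (code_term t) -> den w v n ->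
  (forall w' y, ext w w' -> den w' y (code (subst n t f)) -> holds w' (P y) Q) ->
  holds w (atSubst p x v P) Q.
Proof.
move=> dp dx dv H.
apply: (@holds_congr _ _ _ _ (exists q, Subst n (code_term t) (code f) q /\ Q)).
  apply: holds_ex => w' y q E dy; apply: holds_and_dep.
    by apply: holds_Subst => //; apply: den_ext E _.
  by move=> /Subst_form Eq; apply: H => //; rewrite -Eq.
split=> [[q []] //|HQ]; exists (code (subst n t f)); split=> //; exact/Subst_form.
Qed.

Lemma holds_SameVal w x y s t : den w x (code_term s) -> den w y (code_term t) ->
  closed_term s -> closed_term t -> holds w (oSameVal x y) (eval env0 s = eval env0 t).
Proof.
move=> dx dy cs ct; apply: (holds_atVal dx cs) => w' a E da.
apply: (holds_atVal (den_ext E dy) ct) => w2 b E2 db.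
by apply: holds_eq => //; apply: den_ext da.
Qed.
End Quantifiers.

Ltac transport_all := match goal with E : ext ?w ?w' |- _ => transport w w' E end.

Ltac interpret_axiom_step := lazymatch goal with
  | |- holds _ _ _ (allTerm _) _ => eapply holds_allTerm; intros; transport_all
  | |- holds _ _ _ (exTerm _) _ => eapply holds_exTerm; intros; transport_all
  | |- holds _ _ _ (allSent _) _ => eapply holds_allSent; intros; transport_all
  | |- holds _ _ _ (allForm1 _) _ => eapply holds_allForm1; intros; transport_all
  | |- holds _ _ _ (atVal _ _) _ => eapply holds_atVal;
        [eassumption | eassumption | intros; transport_all]
  | |- holds _ _ _ (atSubst _ _ _ _) _ => eapply holds_atSubst;
        [eassumption | eassumption | eassumption | intros; transport_all]
  | |- holds _ _ _ (oSameVal _ _) _ => eapply holds_SameVal; eassumption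
  | _ => interpret_step
  end.

Lemma sat_holds X Y e p P : holds X Y (0, e) p P -> P -> sat X Y e (p 0).
Proof. by move=> h; apply: (proj2 h). Qed.

(** Reduces the truth of an axiom to its meaning. *)
Ltac interpret_axiom := eapply sat_holds; [repeat interpret_axiom_step | cbv beta].

(** * Determinateness and the model *)
(** D t is true if t is determinate and is never false, as (D3) and (T2+)
require: they make D t determinate exactly when t is, and then true. *)
Definition predD (A : signed_set) : signed_set := fun b n => b /\ (A true n \/ A false n).

(** The least fixed point.  The detour through a subset B of [det] makes the
definition strictly positive; by monotonicity it is harmless ([det_fix]), and it
provides the induction principle for [det_consistent]. *)
Inductive det : signed_set :=
  Det (B : signed_set) b p : (forall b n, B b n -> det b n) -> closed p ->
    val B (predD B) b env0 p -> det b (code p).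

Lemma predD_mono (A B : signed_set) : (forall b n, A b n -> B b n) ->
  forall b n, predD A b n -> predD B b n.
Proof. by move=> AB b n [? [/AB|/AB]]; split; auto. Qed.

Lemma det_sentence b n : det b n -> exists2 p, closed p & n = code p.
Proof. by case=> B {}b p _ cp _; exists p. Qed.

Lemma det_fix b p : closed p -> det b (code p) <-> val det (predD det) b env0 p.
Proof.
move=> cp; split=> [|H]; last exact: (@Det det).
move En: (code p) => n H; case: H En => B {}b q BD cq Hq /code_inj->.
by apply: val_mono Hq => //; apply: predD_mono.
Qed.

Lemma det_consistent b n : det b n -> ~ det (~~ b) n.
Proof.
elim=> B {}b p _ IH cp H /(det_fix _ cp); apply: val_disjoint H => // b' m.
by case: b' => -[] // _ _ [].
Qed.

Definition D_ext n := det true n \/ det false n.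
(** What is believed true of T inside the scope of T.  Only its intersection with
[D_ext] is constrained by the axioms; this is the largest choice. *)
Definition inner_T n := ~ det false n.
(** Truth values in the structure (N, inner_T, D_ext). *)
Definition inner b p := val (classic_set inner_T) (classic_set D_ext) b env0 p.
Definition T_ext n := exists p, closed p /\ n = code p /\ inner true p.

Lemma T_extE p : closed p -> T_ext (code p) <-> inner true p.
Proof. by move=> cp; split=> [[q [_ [/code_inj<-]]]|H] //; exists p. Qed.

Lemma inner_neg p : inner false p <-> ~ inner true p.
Proof. exact: sat_neg inner_T D_ext env0 p. Qed.

(** [det] is included, sign by sign, in the classical signed sets of [inner_T] and
[D_ext]: for [inner_T] and the sign true, this is consistency. *)
Lemma det_inner b p : closed p -> det b (code p) -> inner b p.
Proof.
move=> cp /(det_fix _ cp); apply: val_mono => -[] n /=.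
- exact: det_consistent.
- by move=> ? /(_ _).
- by case.
- by case.
Qed.

Lemma F_det p : closed p -> det false (code p) <-> D_ext (code p) /\ ~ T_ext (code p).
Proof.
move=> cp; rewrite T_extE //; split=> [H|[[/(det_inner cp)|//]]] //.
by split; [right|apply/inner_neg/det_inner].
Qed.

Lemma numeral_closed n : closed_term (numeral n).
Proof. exact: fvt_numeral. Qed.

Lemma fvt_subst x t s y : closed_term t -> y \in fvt (substt x t s) -> y \in fvt s /\ y <> x.
Proof.
move=> ct; elim: s => //= [z|f s IHs u IHu].
  case: eqP => [_|zx]; first by rewrite ct.
  by rewrite /= inE => /eqP->; split.
by rewrite !mem_cat => /orP[/IHs|/IHu] [-> ?]; rewrite ?orbT.
Qed.

Lemma fv_subst x t p y : closed_term t -> y \in fv (subst x t p) -> y \in fv p /\ y <> x.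
Proof.
move=> ct; elim: p => //= [s u|s|s|p IHp q IHq|z p IH]; try exact: fvt_subst.
- by rewrite !mem_cat => /orP[] /(fvt_subst ct)[-> ?]; rewrite ?orbT.
- by rewrite !mem_cat => /orP[/IHp|/IHq] [-> ?]; rewrite ?orbT.
- case: eqP => [<-|_] /=; rewrite !mem_filter => /andP[yz].
    by move=> ->; rewrite yz; split=> //; apply/eqP.
  by case/IH=> -> ?; rewrite yz.
Qed.

Lemma closed_subst v t p : unary_in v p -> closed_term t -> closed (subst v t p).
Proof.
move=> up ct; apply/nilP => y; apply/negP => /(fv_subst ct)[/up]; done.
Qed.

Lemma closed_all v p : unary_in v p -> closed (FAll v p).
Proof.
by move=> up; apply/nilP => y /=; rewrite mem_filter; apply/negP => /andP[/eqP yv /up].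
Qed.

Lemma closed_and p q : closed p -> closed q -> closed (FAnd p q).
Proof. by rewrite /closed /= => -> ->. Qed.

Lemma closed_eq s t : closed_term s -> closed_term t -> closed (FEq s t).
Proof. by rewrite /closed /closed_term /= => -> ->. Qed.

Lemma val_subst_closed T D b v t p : closed_term t ->
  val T D b env0 (subst v t p) <-> val T D b (upd env0 v (eval env0 t)) p.
Proof. by move=> ct; apply/val_subst/free_for_closed. Qed.

(** Every number is the value of a numeral. *)
Lemma val_all_terms T D v p :
  val T D true env0 (FAll v p) <->
  forall t, closed_term t -> val T D true env0 (subst v t p).
Proof.
split=> [H t ct|H n]; first exact/val_subst_closed.
have /val_subst_closed := H _ (numeral_closed n).
by rewrite eval_numeral; apply; apply: numeral_closed.
Qed.

Lemma val_all_counterexample T D v p :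
  val T D false env0 (FAll v p) <->
  exists t, closed_term t /\ val T D false env0 (subst v t p).
Proof.
split=> [[n H]|[t [ct /val_subst_closed H]]]; last by exists (eval env0 t); auto.
exists (numeral n); split; first exact: numeral_closed.
by apply/val_subst_closed; rewrite ?eval_numeral //; apply: numeral_closed.
Qed.

Notation model := (sat T_ext D_ext).

Lemma model_T1 e : model e (CD_T1 0).
Proof.
rewrite /CD_T1; interpret_axiom => s cs t ct.
rewrite (T_extE (closed_eq cs ct)).
by split=> /eqP.
Qed.

Lemma model_T2 e : model e (CD_T2plus 0).
Proof. by rewrite /CD_T2plus; interpret_axiom => t ct; rewrite (@T_extE (FD t)). Qed.

(** The content of (T3). *)
Lemma D_T n : D_ext n -> inner_T n <-> T_ext n.
Proof.
move=> Dn; have [p cp En] : exists2 p, closed p & n = code p.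
  by case: Dn => /det_sentence.
have := F_det cp; rewrite -En /inner_T; move: Dn; case: (classic (T_ext n)); tauto.
Qed.

Lemma model_T3 e : model e (CD_T3 0).
Proof.
by rewrite /CD_T3; interpret_axiom => t ct /D_T <-; rewrite (@T_extE (FT t)).
Qed.

Lemma model_T4 e : model e (CD_T4 0).
Proof.
rewrite /CD_T4; interpret_axiom => p cp.
by rewrite (@T_extE (FNeg p)) // T_extE // -inner_neg.
Qed.

Lemma model_T5 e : model e (CD_T5 0).
Proof.
rewrite /CD_T5; interpret_axiom => p cp q cq.
by rewrite (T_extE (closed_and cp cq)) !T_extE.
Qed.

Lemma model_T6 e : model e (CD_T6 0).
Proof.
rewrite /CD_T6; interpret_axiom => v p up.
rewrite (T_extE (closed_all up)) /inner val_all_terms.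
by split=> H t ct; have := H t ct; rewrite T_extE //; apply: closed_subst.
Qed.

Lemma D_extE p : closed p -> D_ext (code p) <->
  val det (predD det) true env0 p \/ val det (predD det) false env0 p.
Proof. by move=> cp; rewrite /D_ext !det_fix. Qed.

Lemma model_D1 e : model e (CD_D1 0).
Proof.
rewrite /CD_D1; interpret_axiom => s cs t ct.
rewrite (D_extE (closed_eq cs ct)) /=.
by case: eqP; auto.
Qed.

Lemma model_D2 e : model e (CD_D2 0).
Proof. by rewrite /CD_D2; interpret_axiom => t ct; rewrite (@D_extE (FT t)). Qed.

Lemma model_D3 e : model e (CD_D3 0).
Proof.
rewrite /CD_D3; interpret_axiom => t ct; rewrite (@D_extE (FD t)) //=.
by rewrite /predD /D_ext; intuition.
Qed.

Lemma model_D4 e : model e (CD_D4 0).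
Proof.
rewrite /CD_D4; interpret_axiom => p cp; rewrite (@D_extE (FNeg p)) // D_extE //=.
tauto.
Qed.

(** The disjuncts of (D5) and (D6) with a negation express determinate falsity. *)
Lemma D_F p : closed p -> D_ext (code p) /\ T_ext (code (FNeg p)) <-> det false (code p).
Proof.
by move=> cp; rewrite F_det // (@T_extE (FNeg p)) // T_extE // -inner_neg.
Qed.

Lemma model_D5 e : model e (CD_D5 0).
Proof.
rewrite /CD_D5; interpret_axiom => p cp q cq.
rewrite (D_extE (closed_and cp cq)) /= (D_F cp) (D_F cq) -!det_fix //.
rewrite /D_ext; tauto.
Qed.

Lemma model_D6 e : model e (CD_D6 0).
Proof.
rewrite /CD_D6; interpret_axiom => v p up.
rewrite (D_extE (closed_all up)) val_all_terms val_all_counterexample.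
have cs t : closed_term t -> closed (subst v t p) by apply: closed_subst.
split=> [[H|[t [ct]]]|[H|[t [ct]]]].
- by left=> t ct; left; apply/det_fix; auto.
- by move/det_fix => /(_ (cs t ct)) H; right; exists t; split=> //; apply/D_F; auto.
- case: (classic (exists t, closed_term t /\ val det (predD det) false env0 (subst v t p))).
    by right.
  move=> noF; left=> t ct; case: (H t ct) => /(det_fix _ (cs t ct)) // F.
  by case: noF; exists t.
- by move/(D_F (cs t ct))/(det_fix _ (cs t ct)); right; exists t.
Qed.

Lemma val_subst_same T D b v s t p : closed_term s -> closed_term t -> eval env0 s = eval env0 t ->
  val T D b env0 (subst v s p) <-> val T D b env0 (subst v t p).
Proof. by move=> cs ct E; rewrite !val_subst_closed // E. Qed.

Lemma model_R1 e : model e (CD_R1 0).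
Proof.
rewrite /CD_R1; interpret_axiom => v p up s cs t ct E.
by rewrite !T_extE; try exact: closed_subst; apply: val_subst_same.
Qed.

Lemma model_R2 e : model e (CD_R2 0).
Proof.
rewrite /CD_R2; interpret_axiom => v p up s cs t ct E.
rewrite !D_extE; try exact: closed_subst.
by rewrite !(val_subst_same _ _ _ _ _ cs ct E).
Qed.

Lemma model_PA p e : List.In p PA_basic -> model e (p 0).
Proof.
repeat (case=> [<-|]; first (interpret_axiom; try by (intros; reflexivity))); last done.
- by [].
- by move=> m n [].
- exact: addn0.
- exact: addnS.
- exact: muln0.
- exact: mulnSr.
Qed.

Lemma model_CD p e : CDplus p -> model e p.
Proof.
case=> {}p; [exact: model_PA | by move=> q; apply: sat_induction |].
rewrite /CD_axioms /=.
case=> [<-|]; first exact: model_T1.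
case=> [<-|]; first exact: model_T2.
case=> [<-|]; first exact: model_T3.
case=> [<-|]; first exact: model_T4.
case=> [<-|]; first exact: model_T5.
case=> [<-|]; first exact: model_T6.
case=> [<-|]; first exact: model_D1.
case=> [<-|]; first exact: model_D2.
case=> [<-|]; first exact: model_D3.
case=> [<-|]; first exact: model_D4.
case=> [<-|]; first exact: model_D5.
case=> [<-|]; first exact: model_D6.
case=> [<-|]; first exact: model_R1.
by case=> [<-|//]; apply: model_R2.
Qed.

(** T(0) is determinate only if 0 codes a sentence, but codes are positive. *)
Lemma T0_not_determinate : ~ D_ext (code (FT Zero)).
Proof. by rewrite D_extE //= => -[] /det_sentence[[]]. Qed.

Lemma T_numeral n : T_ext (code (FT (numeral n))) <-> inner_T n.
Proof.
by rewrite T_extE /inner /= ?eval_numeral //; apply: numeral_closed.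
Qed.

Theorem mainTheorem5 :
  ~ proves CDplus
      (allSent (fun p =>
         oImp (oOr (oT (Tc (num p))) (oT (Fc (num p)))) (oD p)) 0).
Proof.
move=> /soundness /(_ (fun q => @model_CD q env0)).
set thm := allSent _.
have [H _] : holds T_ext D_ext (0, env0) thm (forall p, closed p ->
    T_ext (code (FT (numeral (code p)))) \/
    T_ext (code (FT (negc (numeral (code p))))) -> D_ext (code p)).
  by rewrite /thm; repeat interpret_axiom_step.
move/H => /(_ (FT Zero) erefl) TD; apply: T0_not_determinate (TD _); left.
by apply/T_numeral => F; apply: T0_not_determinate; right.
Qed.
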